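(* Let $I\neq J$ be $k$-subsets of $\{1,\dots,n\}$ and let $L_I$, $L_J$ be the corresponding rank $1$ Cohen-Macaulay modules. Let $s$ be the number of $LR$ trapezia (boxes) for the rims $I$ and $J$, and let $D^*$ be the matrix over $\mathbb F[t]$ associated with $(I,J)$ defined in the context. Then, as modules over the centre $\mathbb F[t]$, $$\mathrm{Ext}^1_B(L_I,L_J)\cong \mathbb F[t]/(t^{h_1})\times \mathbb F[t]/(t^{h_2})\times\cdots\times \mathbb F[t]/(t^{h_{s-1}}),$$ where $0\le h_1\le h_2\le\dots\le h_{s-1}$ and the nonzero invariant factors of $D^*$ are $1,\dots,1,t^{h_1},\dots,t^{h_{s-1}}$ (an empty product, i.e. the zero module, if $s=1$).
   Context: Let $\mathbb F$ be an algebraically closed field, and let $n\ge 2$ and $1\le k\le n-1$ be integers. Elements of $\{1,\dots,n\}$ are read modulo $n$; $(a,b]$ denotes the cyclic interval $\{a+1,\dots,b\}$ modulo $n$. Let $B$ be the quotient of the path algebra over $\mathbb F$ of the quiver with vertex set $\mathbb Z_n$ and arrows $x_i:i-1\to i$, $y_i:i\to i-1$ ($i\in\mathbb Z_n$) by the relations $xy=yx$ and $x^k=y^{n-k}$, one of each kind starting at every vertex (that is, $x_iy_i=y_{i+1}x_{i+1}$ at vertex $i$, paths composed as functions, and the length-$k$ path of $x$'s from $i$ to $i+k$ equals the length-$(n-k)$ path of $y$'s from $i$ to $i+k$). Its centre is $\mathbb F[t]$, $t=\sum_i x_iy_i$. Modules are left modules, i.e. representations of the quiver. Cohen-Macaulay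 modules are those free over $\mathbb F[t]$. For a $k$-subset $I\subseteq\{1,\dots,n\}$ (the rim), the rank $1$ module $L_I$ has a copy $U_i=\mathbb F[t]$ at each vertex $i$; $x_i:U_{i-1}\to U_i$ is multiplication by $1$ if $i\in I$ and by $t$ if $i\notin I$; $y_i:U_i\to U_{i-1}$ is multiplication by $t$ if $i\in I$ and by $1$ if $i\notin I$. The number $s$: read the elements of the symmetric difference of $I$ and $J$ in cyclic order, writing the letter $L$ for each element of $J\setminus I$ and the letter $R$ for each element of $I\setminus J$. Collapse maximal (cyclic) runs of equal letters to a single letter; up to cyclic rotation the resulting word is $(LR)^s$. This defines $s\ge 1$ (for $I\ne J$), the number of $LR$ boxes (trapezia) for $I$ and $J$. The matrix $D^*$: let $U=\{u\notin I: u+1\in I\}$ and $V=\{v\in I: v+1\notin I\}$; these alternate in cyclic order. $D^*=(d^*_{vu})_{v\in V,u\in U}$ with $d^*_{vu}=t^{a}$, $a=\#\big((u,v]\setminus J\big)$, if $u$ is the element of $U$ immediately preceding $v$; $d^*_{vu}=-t^{b}$, $b=\#\big(J\cap(v,u]\big)$, if $u$ is the element of $U$ immediately following $v$; $d^*_{vu}=0$ otherwise. (If $|U|=1$ the two contributions are added, giving $D^*=(0)$.) *)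

(* Defs.v *)
From HB Require Import structures.
From mathcomp Require Import all_boot all_order all_algebra.
From mathcomp Require Import boolp.
From mathcomp Require Import freeg.

Set Implicit Arguments.
Unset Strict Implicit.
Unset Printing Implicit Defensive.

Import GRing.Theory.
Local Open Scope ring_scope.
Local Open Scope quotient_scope.

Local Obligation Tactic := idtac.

Section Modules.
Variable R : comNzRingType.

Definition mod_iso (V W : lmodType R) : Prop :=
  exists f : {linear V -> W}, bijective f.

Section QuotientModule.
Variables (V : lmodType R) (S : submodClosed V).

Definition submod_pred : {pred V} := S.
HB.instance Definition _ := GRing.isZmodClosed.Build V submod_pred
  (GRing.submod_closedB (GRing.submodClosedP S)).

Definition quotmod : Type := ring_quotient.Quotient.quot submod_pred.
HB.instance Definition _ := GRing.Zmodule.on quotmod.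

Definition quot_proj (v : V) : quotmod := \pi_(ring_quotient.Quotient.quot submod_pred) v.

Definition quot_scale (a : R) (q : quotmod) : quotmod :=
  quot_proj (a *: repr (q : ring_quotient.Quotient.quot submod_pred)).

Lemma quot_projP (u v : V) : quot_proj u = quot_proj v <-> u - v \in S.
Proof.
rewrite -[_ \in S]/(ring_quotient.Quotient.equiv submod_pred u v).
by rewrite ring_quotient.Quotient.equivE ring_quotient.Quotient.idealrBE; split=> /eqP.
Qed.

Lemma quot_proj_surj (q : quotmod) : exists v, quot_proj v = q.
Proof. by exists (repr (q : ring_quotient.Quotient.quot submod_pred)); exact: reprK. Qed.

Lemma quot_projD u v : quot_proj (u + v) = quot_proj u + quot_proj v.
Proof. exact: ring_quotient.Quotient.pi_add. Qed.

Lemma quot_scaleE a v : quot_scale a (quot_proj v) = quot_proj (a *: v).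
Proof.
apply/quot_projP; rewrite -scalerBr; apply: rpredZ; apply/quot_projP.
exact: reprK.
Qed.

Fact quot_scaleA a b q : quot_scale a (quot_scale b q) = quot_scale (a * b) q.
Proof. by have [v <-] := quot_proj_surj q; rewrite !quot_scaleE scalerA. Qed.
Fact quot_scale1 : left_id 1 quot_scale.
Proof. by move=> q; have [v <-] := quot_proj_surj q; rewrite quot_scaleE scale1r. Qed.
Fact quot_scaleDr : right_distributive quot_scale +%R.
Proof.
move=> a q r; have [u <-] := quot_proj_surj q; have [v <-] := quot_proj_surj r.
by rewrite -quot_projD !quot_scaleE scalerDr quot_projD.
Qed.
Fact quot_scaleDl q : {morph quot_scale^~ q : a b / a + b}.
Proof.
move=> a b; have [v <-] := quot_proj_surj q.
by rewrite !quot_scaleE scalerDl quot_projD.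
Qed.
HB.instance Definition _ := GRing.Zmodule_isLmodule.Build R quotmod
  quot_scaleA quot_scale1 quot_scaleDr quot_scaleDl.

End QuotientModule.

Section ProductModule.
Variables (I : Type) (V : I -> lmodType R).

Definition prodmod : Type := forall i, V i.
Implicit Types u v w : prodmod.

HB.instance Definition _ := gen_eqMixin prodmod.
HB.instance Definition _ := gen_choiceMixin prodmod.

Definition prod_zero : prodmod := fun=> 0.
Definition prod_opp u : prodmod := fun i => - u i.
Definition prod_add u v : prodmod := fun i => u i + v i.
Definition prod_scale (a : R) u : prodmod := fun i => a *: u i.

Fact prod_addA : associative prod_add.
Proof. by move=> u v w; apply/functional_extensionality_dep => i; exact: addrA. Qed.
Fact prod_addC : commutative prod_add.
Proof. by move=> u v; apply/functional_extensionality_dep => i; exact: addrC. Qed.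
Fact prod_add0 : left_id prod_zero prod_add.
Proof. by move=> u; apply/functional_extensionality_dep => i; exact: add0r. Qed.
Fact prod_addN : left_inverse prod_zero prod_opp prod_add.
Proof. by move=> u; apply/functional_extensionality_dep => i; exact: addNr. Qed.
HB.instance Definition _ :=
  GRing.isZmodule.Build prodmod prod_addA prod_addC prod_add0 prod_addN.

Fact prod_scaleA a b u : prod_scale a (prod_scale b u) = prod_scale (a * b) u.
Proof. by apply/functional_extensionality_dep => i; exact: scalerA. Qed.
Fact prod_scale1 : left_id 1 prod_scale.
Proof. by move=> u; apply/functional_extensionality_dep => i; exact: scale1r. Qed.
Fact prod_scaleDr : right_distributive prod_scale +%R.
Proof. by move=> a u v; apply/functional_extensionality_dep => i; exact: scalerDr. Qed.
Fact prod_scaleDl u : {morph prod_scale^~ u : a b / a + b}.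
Proof. by move=> a b; apply/functional_extensionality_dep => i; exact: scalerDl. Qed.
HB.instance Definition _ := GRing.Zmodule_isLmodule.Build R prodmod
  prod_scaleA prod_scale1 prod_scaleDr prod_scaleDl.

End ProductModule.

End Modules.

(* V as a module over F[t], with t acting as T *)
Definition polymod (F : fieldType) (V : lmodType F) (T : {linear V -> V}) : Type := V.

Section PolynomialAction.
Variables (F : fieldType) (V : lmodType F) (T : {linear V -> V}).
Implicit Types (p q : {poly F}) (u v : V).

Definition poly_act (p : {poly F}) (v : V) : V :=
  \sum_(i < size p) p`_i *: iter i T v.

Lemma poly_act_wide m p v : (size p <= m)%N ->
  poly_act p v = \sum_(i < m) p`_i *: iter i T v.
Proof.
move=> le; rewrite /poly_act (big_ord_widen m (fun i => p`_i *: iter i T v)) //.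
rewrite big_mkcond; apply: eq_bigr => i _; case: ltnP => // /leq_sizeP->//.
by rewrite scale0r.
Qed.

Fact poly_actDl v : {morph poly_act^~ v : p q / p + q}.
Proof.
move=> p q; pose m := maxn (size p) (size q).
rewrite !(@poly_act_wide m) ?leq_maxl ?leq_maxr ?size_polyD // -big_split /=.
by apply: eq_bigr => i _; rewrite coefD scalerDl.
Qed.

Lemma iterTD i u v : iter i T (u + v) = iter i T u + iter i T v.
Proof. by elim: i => //= i ->; rewrite linearD. Qed.
Lemma iterTZ i a v : iter i T (a *: v) = a *: iter i T v.
Proof. by elim: i => //= i ->; rewrite linearZ. Qed.

Fact poly_actDr : right_distributive poly_act +%R.
Proof.
move=> p u v; rewrite /poly_act -big_split.
by apply: eq_bigr => i _; rewrite iterTD scalerDr.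
Qed.

Lemma poly_actC c v : poly_act c%:P v = c *: v.
Proof.
by rewrite (@poly_act_wide 1) ?size_polyC ?leq_b1 // big_ord1 coefC.
Qed.

Lemma poly_actMX p v : poly_act (p * 'X) v = T (poly_act p v).
Proof.
rewrite (@poly_act_wide (size p).+1) ?(leq_trans (size_polyMleq _ _)) ?size_polyX ?addn2 //.
rewrite big_ord_recl coefMX eqxx scale0r add0r linear_sum.
by apply: eq_bigr => i _; rewrite coefMX linearZ.
Qed.

Lemma poly_actZl c p v : poly_act (c *: p) v = c *: poly_act p v.
Proof.
rewrite (@poly_act_wide (size p)) ?size_scale_leq // scaler_sumr.
by apply: eq_bigr => i _; rewrite coefZ scalerA.
Qed.

Fact poly_actA p q v : poly_act p (poly_act q v) = poly_act (p * q) v.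
Proof.
elim/poly_ind: p => [|p c IH]; first by rewrite mul0r -[0]polyC0 !poly_actC !scale0r.
rewrite mulrDl !poly_actDl poly_actC poly_actMX IH; congr (_ + _).
  by rewrite -mulrA ['X * q]mulrC mulrA poly_actMX.
by rewrite mul_polyC poly_actZl.
Qed.

Lemma poly_actZ p c v : poly_act p (c *: v) = c *: poly_act p v.
Proof.
rewrite /poly_act scaler_sumr.
by apply: eq_bigr => i _; rewrite iterTZ !scalerA mulrC.
Qed.

Fact poly_act1 : left_id 1 poly_act.
Proof. by move=> v; rewrite -[1]polyC1 poly_actC scale1r. Qed.

HB.instance Definition _ := GRing.Zmodule.on (polymod T).
HB.instance Definition _ := GRing.Zmodule_isLmodule.Build {poly F} (polymod T)
  poly_actA poly_act1 poly_actDr poly_actDl.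

End PolynomialAction.

Section Representations.
Variables (F : fieldType) (n k : nat).

(* The arrows of the quiver between adjacent vertices j and i = j + 1:
   x_i : j -> i and y_i : i -> j. *)
Record quiver_rep := QuiverRep {
  qspace :> 'Z_n -> lmodType F;
  qx : forall j i, i = j + 1 -> {linear qspace j -> qspace i};
  qy : forall j i, i = j + 1 -> {linear qspace i -> qspace j} }.

Section Paths.
Variable M : quiver_rep.

Fact path_end0 (i j : 'Z_n) : j = i + 0%:R -> i = j.
Proof. by rewrite addr0. Qed.
Fact path_endS (i j : 'Z_n) m : j = i + m.+1%:R -> j = (i + m%:R) + 1.
Proof. by move->; rewrite -addrA -natr1. Qed.

Fact path_startS (i j : 'Z_n) m : j = i + m.+1%:R -> j = (i + 1) + m%:R.
Proof. by move->; rewrite -addrA -nat1r. Qed.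

(* The actions of the path of m x's from i to i + m and of the path of m y's
   from i + m to i; the empty path acts as the identity. *)
Fixpoint xpath m (i j : 'Z_n) : j = i + m%:R -> M i -> M j :=
  match m with
  | 0 => fun e v => ecast z (M z) (path_end0 e) v
  | m'.+1 => fun e v => qx M (path_endS e) (xpath (erefl (i + m'%:R)) v)
  end.

Fixpoint ypath m (i j : 'Z_n) : j = i + m%:R -> M j -> M i :=
  match m with
  | 0 => fun e v => ecast z (M z) (esym (path_end0 e)) v
  | m'.+1 => fun e v => qy M (erefl (i + 1)) (ypath (path_startS e) v)
  end.

End Paths.

Definition rel_xy (M : quiver_rep) : Prop :=
  forall (j i l : 'Z_n) (eji : i = j + 1) (eil : l = i + 1) (v : M i),
    qx M eji (qy M eji v) = qy M eil (qx M eil v).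

Definition rel_power (M : quiver_rep) : Prop :=
  forall (i j : 'Z_n) (ex : j = i + k%:R) (ey : i = j + (n - k)%:R) (v : M i),
    xpath ex v = ypath ey v.

Record rep := Rep {
  rep_quiver :> quiver_rep;
  rep_xy : rel_xy rep_quiver;
  rep_power : rel_power rep_quiver }.

Fact pred_succ (i : 'Z_n) : i = (i - 1) + 1.
Proof. by rewrite subrK. Qed.

(* t = sum_i x_i y_i acts on the space at vertex i as x_i y_i. *)
Definition rep_t (M : rep) (i : 'Z_n) : {linear M i -> M i} :=
  qx M (pred_succ i) \o qy M (pred_succ i).

Definition center_mod (M : rep) (i : 'Z_n) : lmodType {poly F} :=
  polymod (rep_t M i).

Record rep_hom (M N : rep) := RepHom {
  hom_fun :> forall i, M i -> N i;
  hom_linear : forall i, linear (@hom_fun i);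
  hom_x : forall j i (e : i = j + 1) (v : M j),
    @hom_fun i (qx M e v) = qx N e (@hom_fun j v);
  hom_y : forall j i (e : i = j + 1) (v : M i),
    @hom_fun j (qy M e v) = qy N e (@hom_fun i v) }.
Arguments hom_fun {M N} f i : rename.
HB.instance Definition _ M N (f : rep_hom M N) i :=
  GRing.isLinear.Build F (M i) (N i) *:%R (f i) (@hom_linear M N f i).

Lemma rep_homP M N (f g : rep_hom M N) : (forall i, f i =1 g i) <-> f = g.
Proof.
split=> [|-> //]; case: f g => [f fl fx fy] [g gl gx gy] /= fg.
have {}fg : f = g.
  by apply/functional_extensionality_dep => i; apply/funext => v; exact: fg.
by case: _ / fg gl gx gy => *; congr RepHom; exact: Prop_irrelevance.
Qed.

Section HomModule.
Variables M N : rep.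
Implicit Types f g h : rep_hom M N.

HB.instance Definition _ := gen_eqMixin (rep_hom M N).
HB.instance Definition _ := gen_choiceMixin (rep_hom M N).

Program Definition hom_zero : rep_hom M N :=
  @RepHom M N (fun i _ => 0) _ _ _.
Next Obligation. by move=> i a u v /=; rewrite scaler0 addr0. Qed.
Next Obligation. by move=> * /=; rewrite linear0. Qed.
Next Obligation. by move=> * /=; rewrite linear0. Qed.

Program Definition hom_opp f : rep_hom M N :=
  @RepHom M N (fun i v => - f i v) _ _ _.
Next Obligation. by move=> f i a u v /=; rewrite linearP opprD scalerN. Qed.
Next Obligation. by move=> * /=; rewrite hom_x linearN. Qed.
Next Obligation. by move=> * /=; rewrite hom_y linearN. Qed.

Program Definition hom_add f g : rep_hom M N :=
  @RepHom M N (fun i v => f i v + g i v) _ _ _.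
Next Obligation. by move=> f g i a u v /=; rewrite !linearP scalerDr addrACA. Qed.
Next Obligation. by move=> * /=; rewrite !hom_x linearD. Qed.
Next Obligation. by move=> * /=; rewrite !hom_y linearD. Qed.

Lemma rep_t_x (K : rep) j i (e : i = j + 1) (v : K j) :
  rep_t K i (qx K e v) = qx K e (rep_t K j v).
Proof.
rewrite /rep_t /=.
have ej : j = i - 1 by rewrite e addrK.
move: e (pred_succ i) v; case: _ / ej => e e' v.
by rewrite (eq_irrelevance e' e) (rep_xy (pred_succ j) e).
Qed.

Lemma rep_t_y (K : rep) j i (e : i = j + 1) (v : K i) :
  rep_t K j (qy K e v) = qy K e (rep_t K i v).
Proof.
rewrite /rep_t /=.
have ej : j = i - 1 by rewrite e addrK.
move: e (pred_succ i) v; case: _ / ej => e e' v.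
by rewrite (eq_irrelevance e' e) (rep_xy (pred_succ j) e).
Qed.

Lemma poly_act_hom (U V : lmodType F) (S : {linear U -> U}) (T : {linear V -> V})
    (f : {linear U -> V}) : (forall u, f (S u) = T (f u)) ->
  forall p u, f (poly_act S p u) = poly_act T p (f u).
Proof.
move=> fST p u; rewrite /poly_act linear_sum; apply: eq_bigr => i _.
by rewrite linearZ; congr (_ *: _); elim: (i : nat) => //= m <-.
Qed.

(* F[t] acts through the target (equivalently, the source) of a morphism. *)
Program Definition hom_scale (p : {poly F}) f : rep_hom M N :=
  @RepHom M N (fun i v => (p *: (f i v : center_mod N i) : center_mod N i)) _ _ _.
Next Obligation.
move=> p f i a u v /=; rewrite linearP.
by rewrite [LHS]poly_actDr [X in X + _]poly_actZ.
Qed.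
Next Obligation.
move=> p f j i e v /=; rewrite hom_x; symmetry; apply: poly_act_hom => w.
by rewrite rep_t_x.
Qed.
Next Obligation.
move=> p f j i e v /=; rewrite hom_y; symmetry; apply: poly_act_hom => w.
by rewrite rep_t_y.
Qed.

Fact hom_addA : associative hom_add.
Proof. by move=> f g h; apply/rep_homP => i v; exact: addrA. Qed.
Fact hom_addC : commutative hom_add.
Proof. by move=> f g; apply/rep_homP => i v; exact: addrC. Qed.
Fact hom_add0 : left_id hom_zero hom_add.
Proof. by move=> f; apply/rep_homP => i v; exact: add0r. Qed.
Fact hom_addN : left_inverse hom_zero hom_opp hom_add.
Proof. by move=> f; apply/rep_homP => i v; exact: addNr. Qed.
HB.instance Definition _ :=
  GRing.isZmodule.Build (rep_hom M N) hom_addA hom_addC hom_add0 hom_addN.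

Fact hom_scaleA p q f : hom_scale p (hom_scale q f) = hom_scale (p * q) f.
Proof. by apply/rep_homP => i v; exact: (@scalerA _ (center_mod N i)). Qed.
Fact hom_scale1 : left_id 1 hom_scale.
Proof. by move=> f; apply/rep_homP => i v; exact: (@scale1r _ (center_mod N i)). Qed.
Fact hom_scaleDr : right_distributive hom_scale +%R.
Proof. by move=> p f g; apply/rep_homP => i v; exact: (@scalerDr _ (center_mod N i)). Qed.
Fact hom_scaleDl f : {morph hom_scale^~ f : p q / p + q}.
Proof. by move=> p q; apply/rep_homP => i v; exact: (@scalerDl _ (center_mod N i)). Qed.
HB.instance Definition _ := GRing.Zmodule_isLmodule.Build {poly F} (rep_hom M N)
  hom_scaleA hom_scale1 hom_scaleDr hom_scaleDl.

End HomModule.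

Program Definition hom_comp (M N K : rep) (g : rep_hom N K) (f : rep_hom M N) :
  rep_hom M K := @RepHom M K (fun i v => g i (f i v)) _ _ _.
Next Obligation. by move=> M N K g f i a u v /=; rewrite !linearP. Qed.
Next Obligation. by move=> * /=; rewrite !hom_x. Qed.
Next Obligation. by move=> * /=; rewrite !hom_y. Qed.

Definition hom_surj (M N : rep) (f : rep_hom M N) : Prop :=
  forall i (v : N i), exists u, f i u = v.

Definition exact_at (M N K : rep) (f : rep_hom M N) (g : rep_hom N K) : Prop :=
  forall i (v : N i), g i v = 0 <-> exists u, f i u = v.

Definition projective (P : rep) : Prop :=
  forall (M N : rep) (g : rep_hom M N) (f : rep_hom P N),
    hom_surj g -> exists h : rep_hom P M, hom_comp g h = f.

Record proj_resolution (M : rep) := ProjResolution {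
  res_obj : nat -> rep;
  res_d : forall m, rep_hom (res_obj m.+1) (res_obj m);
  res_aug : rep_hom (res_obj 0) M;
  res_proj : forall m, projective (res_obj m);
  res_surj : hom_surj res_aug;
  res_exact0 : exact_at (res_d 0) res_aug;
  res_exact : forall m, exact_at (res_d m.+1) (res_d m) }.

Section Ext.
Variables (M : rep) (P : proj_resolution M) (N : rep).

Definition cocycle1 : {pred rep_hom (res_obj P 1) N} :=
  fun f => `[< hom_comp f (res_d P 1) = 0 >].

Fact cocycle1_closed : submod_closed cocycle1.
Proof.
split=> [|p f g /asboolP f0 /asboolP g0]; apply/asboolP; apply/rep_homP => i v //=.
have /rep_homP/(_ i v) /= {}f0 := f0; have /rep_homP/(_ i v) /= {}g0 := g0.
by rewrite -[LHS]/(p *: (f i _ : center_mod N i) + g i _) f0 g0 scaler0 addr0.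
Qed.
HB.instance Definition _ :=
  GRing.isSubmodClosed.Build {poly F} (rep_hom (res_obj P 1) N) cocycle1 cocycle1_closed.

Record Z1 := MkZ1 { z1_val :> rep_hom (res_obj P 1) N; z1P : z1_val \in cocycle1 }.
HB.instance Definition _ := [isSub for z1_val].
HB.instance Definition _ := [Choice of Z1 by <:].
HB.instance Definition _ := [SubChoice_isSubLmodule of Z1 by <:].

Definition coboundary1 : {pred Z1} :=
  fun f => `[< exists g : rep_hom (res_obj P 0) N, val f = hom_comp g (res_d P 0) >].

Fact coboundary1_closed : submod_closed coboundary1.
Proof.
split=> [|p f g /asboolP[f' ff'] /asboolP[g' gg']]; apply/asboolP.
  by exists 0; apply/rep_homP.
exists (p *: f' + g'); rewrite linearP /= ff' gg'.
by apply/rep_homP.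
Qed.
HB.instance Definition _ :=
  GRing.isSubmodClosed.Build {poly F} Z1 coboundary1 coboundary1_closed.

(* H^1 (Hom (P, N)). By the comparison theorem it does not depend on the
   projective resolution P of M, and P exists: see proj_resolution_exists. *)
Definition Ext1 : lmodType {poly F} := quotmod coboundary1.

End Ext.

End Representations.

Section RankOne.
Variables (F : fieldType) (n k : nat).
Implicit Types I J : {set 'Z_n}.

Definition poly_mul (a p : {poly F}) : {poly F} := a * p.
Fact poly_mul_linear a : linear (poly_mul a).
Proof. by move=> c p q; rewrite /poly_mul mulrDr scalerAr. Qed.
HB.instance Definition _ a :=
  GRing.isLinear.Build F {poly F} {poly F} *:%R (poly_mul a) (poly_mul_linear a).

(* the indeterminate 'X of {poly F} is t *)
Definition rim_x I (i : 'Z_n) : {poly F} := if i \in I then 1 else 'X.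
Definition rim_y I (i : 'Z_n) : {poly F} := if i \in I then 'X else 1.

Definition rank1_quiver I : quiver_rep F n :=
  @QuiverRep F n (fun=> {poly F})
    (fun _ i _ => poly_mul (rim_x I i)) (fun _ i _ => poly_mul (rim_y I i)).

Lemma rim_xy I i : rim_x I i * rim_y I i = 'X.
Proof. by rewrite /rim_x /rim_y; case: ifP; rewrite ?mul1r ?mulr1. Qed.

Lemma sum_cycle I i : (1 < n)%N ->
  (\sum_(m < n) (i + m%:R + 1 \in I)%R = #|I|)%N.
Proof.
move=> hn; case: n hn I i => [|[|n']] // _ I i.
rewrite -sum1_card [RHS]big_mkcond [RHS](reindex (fun m : 'Z_n'.+2 => i + m + 1)).
  by apply: eq_bigr => m _; rewrite (natr_Zp (m : 'Z_n'.+2)); case: (_ \in _).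
exists (fun z => z - 1 - i) => m _; first by rewrite addrK addrC addKr.
by rewrite [i + _]addrC !subrK.
Qed.

Lemma prod_rim_x I i m :
  \prod_(l < m) rim_x I (i + l%:R + 1) =
  'X^(\sum_(l < m) (i + l%:R + 1 \notin I)%R).
Proof.
elim: m => [|m IH]; first by rewrite !big_ord0.
by rewrite !big_ord_recr /= IH exprD /rim_x; case: (_ \in _).
Qed.

Lemma prod_rim_y I i m :
  \prod_(l < m) rim_y I (i + l%:R + 1) =
  'X^(\sum_(l < m) (i + l%:R + 1 \in I)%R).
Proof.
elim: m => [|m IH]; first by rewrite !big_ord0.
by rewrite !big_ord_recr /= IH exprD /rim_y; case: (_ \in _).
Qed.

Lemma rim_power I i j : (1 < n)%N -> #|I| = k -> j = i + k%:R ->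
  \prod_(l < k) rim_x I (i + l%:R + 1) =
  \prod_(l < n - k) rim_y I (j + l%:R + 1).
Proof.
move=> hn hI ->; rewrite prod_rim_x prod_rim_y; congr ('X^_).
have le_kn : (k <= n)%N.
  by rewrite -hI (leq_trans (max_card _)) // card_ord Zp_cast.
have split (f : nat -> nat) :
    (\sum_(l < n) f l = \sum_(l < k) f l + \sum_(l < n - k) f (k + l))%N.
  rewrite -(big_mkord xpredT f) (@big_cat_nat _ _ _ k) //= big_mkord; congr (_ + _)%N.
  by rewrite -{1}[k]add0n big_addn big_mkord; apply: eq_bigr => l _; rewrite addnC.
have := sum_cycle I i hn; rewrite hI (split (fun l => (i + l%:R + 1)%R \in I)).
have : (\sum_(l < k) (i + l%:R + 1 \notin I)%R +
        \sum_(l < k) (i + l%:R + 1 \in I)%R = k)%N.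
  rewrite -big_split /= -[RHS]card_ord -sum1_card.
  by apply: eq_bigr => l _; case: (_ \in _).
move=> e1 e2; apply/eqP; rewrite -(eqn_add2r (\sum_(l < k) (i + l%:R + 1 \in I)%R)).
rewrite e1 addnC -[X in X == _]e2; apply/eqP; congr (_ + _)%N.
by apply: eq_bigr => l _; rewrite natrD [i + (_ + _)]addrA.
Qed.

Lemma rank1_xpath I m i j (e : j = i + m%:R) (p : {poly F}) :
  @xpath F n (rank1_quiver I) m i j e p =
  (\prod_(l < m) rim_x I (i + l%:R + 1)) * p.
Proof.
elim: m j e => [|m IH] j e /=.
  by rewrite big_ord0 mul1r; case: _ / (path_end0 e).
by rewrite IH big_ord_recr /= /poly_mul (path_endS e) mulrA [rim_x _ _ * _]mulrC.
Qed.

Lemma rank1_ypath I m i j (e : j = i + m%:R) (p : {poly F}) :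
  @ypath F n (rank1_quiver I) m i j e p =
  (\prod_(l < m) rim_y I (i + l%:R + 1)) * p.
Proof.
elim: m i e => [|m IH] i e /=.
  by rewrite big_ord0 mul1r; case: _ / (esym _).
rewrite IH big_ord_recl /= /poly_mul addr0 mulrA; congr (_ * _ * _).
by apply: eq_bigr => l _; rewrite -[bump 0 l]/(l.+1) -nat1r addrA.
Qed.

Variable I : {set 'Z_n}.

Fact rank1_xy : rel_xy (rank1_quiver I).
Proof.
by move=> j i l e e' v; rewrite /= /poly_mul !mulrA [rim_y _ _ * _]mulrC !rim_xy.
Qed.

Fact rank1_power : (1 < n)%N -> #|I| = k -> rel_power k (rank1_quiver I).
Proof.
by move=> hn hI i j ex ey v; rewrite rank1_xpath rank1_ypath (rim_power hn hI ex).
Qed.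

Definition rank1 (hn : (1 < n)%N) (hI : #|I| = k) : rep F n k :=
  Rep rank1_xy (rank1_power hn hI).

End RankOne.

Section Combinatorics.
Variable n : nat.
Implicit Types (a b u v : 'Z_n) (I J : {set 'Z_n}).

(* The word of (I, J), with true for the letter L and false for R. *)
Definition LR_word I J : seq bool :=
  [seq i \in J | i <- enum 'Z_n & (i \in I) (+) (i \in J)].

(* Keeps the letters that differ from the cyclically preceding one, that is,
   the first letter of each maximal cyclic run. *)
Definition cyclic_collapse (w : seq bool) : seq bool :=
  [seq p.1 | p <- zip w (rotr 1 w) & p.1 != p.2].

(* The collapsed word is (LR)^s up to rotation. *)
Definition num_boxes I J : nat := (size (cyclic_collapse (LR_word I J)))./2.

(* The cyclic interval (a, b], for a != b; it is empty when a = b. *)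
Definition cyc_interval a b : {set 'Z_n} :=
  [set x | (0 < (x - a)%R <= (b - a)%R)%N].

Definition rim_U I : {set 'Z_n} := [set u | (u \notin I) && (u + 1 \in I)].
Definition rim_V I : {set 'Z_n} := [set v | (v \in I) && (v + 1 \notin I)].

(* For u in rim_U I and v in rim_V I: u is the element of rim_U I immediately
   preceding, resp. following, v in the cyclic order. If rim_U I is a
   singleton then both hold. *)
Definition precedes I u v : bool := cyc_interval u v :&: rim_U I == set0.
Definition follows I u v : bool := cyc_interval v u :&: rim_U I == [set u].

End Combinatorics.

Section Matrix.
Variables (F : fieldType) (n : nat).
Implicit Types I J : {set 'Z_n}.

Definition dstar I J (v u : 'Z_n) : {poly F} :=
  (if precedes I u v then 'X^(#|cyc_interval u v :\: J|) else 0)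
  - (if follows I u v then 'X^(#|J :&: cyc_interval v u|) else 0).

Definition Dstar I J : 'M[{poly F}]_(#|rim_V I|, #|rim_U I|) :=
  \matrix_(i, j) dstar I J (enum_val i) (enum_val j).

(* d lists the nonzero invariant factors of A. *)
Definition invariant_factors p q (A : 'M[{poly F}]_(p, q)) (d : seq {poly F}) : Prop :=
  [/\ (size d <= minn p q)%N, all (fun x => x \is monic) d,
      sorted (@dvdp F) d
    & exists L R, [/\ L \in unitmx, R \in unitmx
      & L *m A *m R = \matrix_(i, j) (d`_i *+ (i == j :> nat))]].

(* The ideal (a), as a submodule of the regular module. *)
Definition ideal (a : {poly F}) : {pred {poly F}^o} := fun p => a %| p.
Fact ideal_closed a : submod_closed (ideal a).
Proof.
split=> [|b p q ap aq]; first by rewrite unfold_in dvdp0.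
by rewrite unfold_in dvdp_add // dvdp_mull.
Qed.
HB.instance Definition _ a :=
  GRing.isSubmodClosed.Build {poly F} {poly F}^o (ideal a) (ideal_closed a).

Definition poly_quot (a : {poly F}) : lmodType {poly F} := quotmod (ideal a).

End Matrix.

(* Existence of projective resolutions, through the direct sums of the
   projectives B e_v, each modelled by the rank 1 representation with rim
   (v, v + k]. *)
Section RestrictScalars.
Variable F : fieldType.

Definition restr (V : lmodType {poly F}) : Type := V.

Section Restr.
Variable V : lmodType {poly F}.
HB.instance Definition _ := GRing.Zmodule.on (restr V).
Definition restr_scale (c : F) (v : restr V) : restr V := c%:P *: (v : V).
Fact restr_scaleA a b v : restr_scale a (restr_scale b v) = restr_scale (a * b) v.
Proof. by rewrite /restr_scale scalerA polyCM. Qed.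
Fact restr_scale1 : left_id 1 restr_scale.
Proof. by move=> v; rewrite /restr_scale polyC1 scale1r. Qed.
Fact restr_scaleDr : right_distributive restr_scale +%R.
Proof. by move=> a u v; exact: scalerDr. Qed.
Fact restr_scaleDl v : {morph restr_scale^~ v : a b / a + b}.
Proof. by move=> a b; rewrite /restr_scale polyCD; exact: scalerDl. Qed.
HB.instance Definition _ := GRing.Zmodule_isLmodule.Build F (restr V)
  restr_scaleA restr_scale1 restr_scaleDr restr_scaleDl.
End Restr.

Definition restr_map (V W : lmodType {poly F}) (f : {linear V -> W}) :
  restr V -> restr W := f.
Fact restr_map_linear (V W : lmodType {poly F}) (f : {linear V -> W}) : linear (restr_map f).
Proof. by move=> c u v; exact: linearP. Qed.
HB.instance Definition _ (V W : lmodType {poly F}) (f : {linear V -> W}) :=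
  GRing.isLinear.Build F (restr V) (restr W) *:%R (restr_map f) (restr_map_linear f).

End RestrictScalars.

Section FreeModules.
Variables (R : comNzRingType) (T : choiceType).
Local Notation free := {freeg T / R}.

Definition fgen (a : T) : free := (<< a >>)%R.

Lemma fgenZ (c : R) a : (<< c *g a >>)%R = c *: fgen a.
Proof.
by apply/eqP/freeg_eqP => b; rewrite coeffZ !coeffU mul1r.
Qed.

Fact fglift_linear (V : lmodType R) (f : T -> V) : linear (@fglift R V T f : free -> V).
Proof.
have fD := lift_is_additive f.
have f0 : fglift f 0 = 0 by have := fD 0 0; rewrite !subr0 subrr.
have fN D : fglift f (- D) = - fglift f D by have := fD 0 D; rewrite f0 !sub0r.
have fA D E : fglift f (D + E) = fglift f D + fglift f E.
  by have := fD D (- E); rewrite fN !opprK.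
have fS I (r : seq I) (G : I -> free) :
    fglift f (\sum_(i <- r) G i) = \sum_(i <- r) fglift f (G i).
  by elim: r => [|i r IH]; rewrite ?big_nil ?f0 // !big_cons fA IH.
move=> p D E; rewrite fA; congr (_ + _).
rewrite -[D]freeg_sumE scaler_sumr !fS scaler_sumr; apply: eq_bigr => a _.
have fZ c : fglift f (c *: fgen a) = c *: f a by rewrite -fgenZ liftU.
by rewrite fgenZ scalerA !fZ scalerA.
Qed.

Definition fext (V : lmodType R) (f : T -> V) : free -> V := fglift f.
HB.instance Definition _ (V : lmodType R) (f : T -> V) :=
  GRing.isLinear.Build R free V *:%R (fext f) (fglift_linear f).

Lemma fextE (V : lmodType R) (f : T -> V) a : fext f (fgen a) = f a.
Proof. by rewrite /fext liftU scale1r. Qed.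

Lemma free_ext (V : lmodType R) (f g : {linear free -> V}) :
  (forall a, f (fgen a) = g (fgen a)) -> f =1 g.
Proof.
move=> fg D; rewrite -[D]freeg_sumE !linear_sum; apply: eq_bigr => a _.
by rewrite fgenZ !linearZ /= fg.
Qed.

Lemma free_ext_add (V : zmodType) (f g : free -> V) :
  {morph f : D E / D + E} -> {morph g : D E / D + E} ->
  (forall p a, f (p *: fgen a) = g (p *: fgen a)) -> f =1 g.
Proof.
move=> fD gD fg D; rewrite -[D]freeg_sumE.
have z (h : free -> V) : {morph h : D E / D + E} -> h 0 = 0.
  by move=> hD; apply: (addrI (h 0)); rewrite -hD !addr0.
elim: (dom D) => [|a r IH]; first by rewrite !big_nil !z.
by rewrite !big_cons fD gD IH fgenZ fg.
Qed.

Definition diag (c : T -> R) : free -> free := fext (fun a => c a *: fgen a).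
HB.instance Definition _ (c : T -> R) :=
  GRing.isLinear.Build R free free *:%R (diag c) (fglift_linear _).

Lemma diagE c a : diag c (fgen a) = c a *: fgen a.
Proof. exact: fextE. Qed.

Lemma diag_comp c d D : diag c (diag d D) = diag (fun a => c a * d a) D.
Proof.
rewrite -[LHS]/((diag c \o diag d) D); move: D.
by apply: free_ext => a; rewrite /= !diagE linearZ /= diagE scalerA mulrC.
Qed.

Lemma diag_eq c d : c =1 d -> diag c =1 diag d.
Proof. by move=> cd; apply: free_ext => a; rewrite /= !diagE cd. Qed.

Lemma diag1 D : diag (fun=> 1) D = D.
Proof.
rewrite -[RHS]/(idfun D); move: D; apply: free_ext => a.
by rewrite /= diagE scale1r.
Qed.

End FreeModules.

Section FreeRepresentations.
Variables (F : fieldType) (n k : nat).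
Hypotheses (hn : (1 < n)%N) (hkn : (k < n)%N).
Implicit Types (M N : rep F n k) (i j v : 'Z_n).

Definition arc (v : 'Z_n) : {set 'Z_n} := [set x | (0 < (x - v)%R <= k)%N].

Lemma card_arc v : #|arc v| = k.
Proof.
rewrite /arc; case: n hn hkn v => [|[|m]] // _ hk v.
rewrite -sum1_card (reindex_onto (fun z => z + v) (fun z => z - v)); last first.
  by move=> z _; rewrite subrK.
rewrite (eq_bigl (fun z : 'I_m.+2 => 0 < z <= k)%N); last first.
  by move=> z; rewrite inE addrK eqxx andbT.
rewrite big_mkcond big_ord_recl /= add0n.
rewrite -[RHS]card_ord -sum1_card (big_ord_widen m.+1 (fun=> 1%N)) //.
by rewrite [RHS]big_mkcond.
Qed.

Section FreeRep.
Variables (T : choiceType) (vx : T -> 'Z_n).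
Local Notation P := (restr {freeg T / {poly F}}).

Definition free_quiver : quiver_rep F n :=
  @QuiverRep F n (fun=> P)
    (fun _ i _ => restr_map (diag (fun a => rim_x F (arc (vx a)) i)))
    (fun _ i _ => restr_map (diag (fun a => rim_y F (arc (vx a)) i))).

Lemma free_xpath m i j (e : j = i + m%:R) (p : P) :
  @xpath F n free_quiver m i j e p =
  diag (fun a => \prod_(l < m) rim_x F (arc (vx a)) (i + l%:R + 1)) p.
Proof.
elim: m j e => [|m IH] j e /=.
  case: _ / (path_end0 e); rewrite -[LHS]diag1.
  by apply: diag_eq => a; rewrite big_ord0.
rewrite IH /restr_map diag_comp; apply: diag_eq => a.
by rewrite big_ord_recr /= (path_endS e) mulrC.
Qed.

Lemma free_ypath m i j (e : j = i + m%:R) (p : P) :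
  @ypath F n free_quiver m i j e p =
  diag (fun a => \prod_(l < m) rim_y F (arc (vx a)) (i + l%:R + 1)) p.
Proof.
elim: m i e => [|m IH] i e /=.
  case: _ / (esym _); rewrite -[LHS]diag1.
  by apply: diag_eq => a; rewrite big_ord0.
rewrite IH /restr_map diag_comp; apply: diag_eq => a.
rewrite big_ord_recl /= addr0; congr (_ * _).
by apply: eq_bigr => l _; rewrite -[bump 0 l]/(l.+1) -nat1r addrA.
Qed.

Fact free_xy : rel_xy free_quiver.
Proof.
move=> j i l e e' v; rewrite /= /restr_map !diag_comp; apply: diag_eq => a.
by rewrite rim_xy mulrC rim_xy.
Qed.

Fact free_power : rel_power k free_quiver.
Proof.
move=> i j ex ey v; rewrite free_xpath free_ypath; apply: diag_eq => a.
by apply: (@rim_power F n k _ i j hn _ ex); exact: card_arc.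
Qed.

Definition free_rep : rep F n k := Rep free_xy free_power.

End FreeRep.

Lemma rep_tE M j i (e : i = j + 1) (v : M i) : rep_t M i v = qx M e (qy M e v).
Proof. by rewrite /rep_t /= (rep_xy (pred_succ i) (erefl (i + 1))) (rep_xy e (erefl (i + 1))). Qed.

Lemma rep_tE' M j i (e : i = j + 1) (v : M j) : rep_t M j v = qy M e (qx M e v).
Proof. exact: rep_xy. Qed.

Lemma act_X M i (v : M i) : 'X *: (v : center_mod M i) = rep_t M i v.
Proof. by rewrite -[X in X *: _]mul1r [LHS]poly_actMX poly_act1. Qed.

Fact gen_end v j : j = v + (j - v)%R%:R.
Proof. by rewrite natr_Zp addrC subrK. Qed.
Fact gen_end' v j : v = j + (n - (j - v)%R)%:R.
Proof.
have n0 : n%:R = 0 :> 'Z_n by rewrite pchar_Zp.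
rewrite natrB ?n0 ?natr_Zp; first by rewrite sub0r opprB addrC subrK.
by rewrite -[X in (_ <= X)%N](Zp_cast hn) ltnW.
Qed.

Definition gen M v j (m : M v) : M j :=
  if ((j - v)%R <= k)%N then xpath (gen_end v j) m else ypath (gen_end' v j) m.

Lemma xpath_irr M m m' v j (e : j = v + m%:R) (e' : j = v + m'%:R) (u : M v) :
  m = m' -> xpath e u = xpath e' u.
Proof. by move=> mm'; case: _ / mm' e' => e'; rewrite (eq_irrelevance e e'). Qed.

Lemma ypath_irr M m m' v j (e : j = v + m%:R) (e' : j = v + m'%:R) (u : M j) :
  m = m' -> ypath e u = ypath e' u.
Proof. by move=> mm'; case: _ / mm' e' => e'; rewrite (eq_irrelevance e e'). Qed.

Lemma dist_lo v j d : j = v + d%:R -> (d < n)%N -> (j - v)%R = d :> nat.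
Proof. by move=> -> dn; rewrite addrAC subrr add0r val_Zp_nat // modn_small. Qed.

Lemma dist_hi v j d : v = j + (n - d)%:R -> (d <= n)%N -> j = v + d%:R.
Proof.
move=> -> dn; rewrite -addrA -natrD subnK //.
by have -> : n%:R = 0 :> 'Z_n; rewrite ?addr0 // pchar_Zp.
Qed.

Lemma gen_lo M v j d (e : j = v + d%:R) (u : M v) :
  (d <= k)%N -> gen j u = xpath e u.
Proof.
move=> dk; have dE := dist_lo e (leq_ltn_trans dk hkn).
by rewrite /gen; case: ifP => [_|]; [exact: xpath_irr | case/negP; rewrite dE].
Qed.

Lemma gen_hi M v j d (e : v = j + (n - d)%:R) (u : M v) :
  (k <= d <= n)%N -> gen j u = ypath e u.
Proof.
case/andP=> kd; rewrite leq_eqVlt => /orP[/eqP dn|dn].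
  have jv : v = j by rewrite e dn subnn addr0.
  have e0 : v = j + 0%:R by rewrite jv addr0.
  have e1 : j = v + 0%:R by rewrite jv addr0.
  rewrite (gen_lo e1) // (ypath_irr e e0) ?dn ?subnn //=.
  by case: _ / jv (path_end0 e1) (path_end0 e0) => p q; rewrite !eq_axiomK.
have e' := dist_hi e (ltnW dn); have dE := dist_lo e' dn.
have [dk|kd'] := leqP d k; last first.
  have kF : ((j - v)%R <= k)%N = false by rewrite dE leqNgt kd'.
  rewrite /gen; case: ifP kF => // _ _.
  by apply: ypath_irr; rewrite dE.
have dkE : d = k by apply/eqP; rewrite eqn_leq dk.
rewrite (gen_lo e') //; clear dE; subst d; exact: (@rep_power _ _ _ M v j e' e u).
Qed.

Lemma gen_self M v (u : M v) : gen v u = u.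
Proof.
have e : v = v + 0%:R by rewrite addr0.
by rewrite (gen_lo e) //=; rewrite eq_axiomK.
Qed.

Lemma arc_succ v j i d : i = j + 1 -> j = v + d%:R -> (d < n)%N ->
  (i \in arc v) = (d < k)%N.
Proof.
move=> ij jd dn; rewrite inE.
have := dn; rewrite leq_eqVlt => /orP[/eqP d1n|d1n].
  have iv : i = v.
    by rewrite ij jd -addrA natr1 d1n pchar_Zp // addr0.
  by rewrite iv subrr /= ltnNge -ltnS d1n hkn.
have /dist_lo -> // : i = v + d.+1%:R by rewrite ij jd -addrA -natr1.
Qed.

Lemma xpath_step M v j i d (e : i = j + 1) (ej : j = v + d%:R)
    (ei : i = v + d.+1%:R) (u : M v) : xpath ei u = qx M e (xpath ej u).
Proof. by subst j; rewrite /= (eq_irrelevance (path_endS ei) e). Qed.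

Lemma ypath_step M v j i d (e : i = j + 1) (ej : v = j + d.+1%:R)
    (ei : v = i + d%:R) (u : M v) : ypath ej u = qy M e (ypath ei u).
Proof. by subst i; rewrite /= (eq_irrelevance (path_startS ej) ei). Qed.

Lemma gen_step M v j i (e : i = j + 1) (u : M v) :
  if i \in arc v then qx M e (gen j u) = gen i u
  else qy M e (gen i u) = gen j u.
Proof.
pose d := (j - v)%R : nat; have ed : j = v + d%:R := gen_end v j.
have dn : (d < n)%N by rewrite -[X in (_ < X)%N](Zp_cast hn) ltn_ord.
have ei : i = v + d.+1%:R by rewrite e ed -addrA -natr1.
rewrite (arc_succ e ed dn); case: ltnP => dk.
  by rewrite (gen_lo ed) ?(ltnW dk) // (gen_lo ei) // (xpath_step e ed).
have n0 : n%:R = 0 :> 'Z_n by rewrite pchar_Zp.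
have fj : v = j + (n - d)%:R by rewrite ed -addrA -natrD subnKC ?n0 ?addr0 // ltnW.
have fi : v = i + (n - d.+1)%:R by rewrite ei -addrA -natrD subnKC ?n0 ?addr0.
have dE : (n - d = (n - d.+1).+1)%N by rewrite -subSn.
have fj' : v = j + (n - d.+1).+1%:R by rewrite -dE.
rewrite (gen_hi fi) ?dn ?(leq_trans dk) // (gen_hi fj) ?dk ?(ltnW dn) //.
by rewrite (ypath_irr fj fj' u dE) (ypath_step e fj' fi).
Qed.

Lemma gen_x M v j i (e : i = j + 1) (u : M v) :
  qx M e (gen j u) = rim_x F (arc v) i *: (gen i u : center_mod M i).
Proof.
have := gen_step e u; rewrite /rim_x; case: ifP => _ <-; first by rewrite scale1r.
by rewrite act_X (rep_tE e).
Qed.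

Lemma gen_y M v j i (e : i = j + 1) (u : M v) :
  qy M e (gen i u) = rim_y F (arc v) i *: (gen j u : center_mod M j).
Proof.
have := gen_step e u; rewrite /rim_y; case: ifP => _ <-; last by rewrite scale1r.
by rewrite act_X (rep_tE' e).
Qed.

Lemma hom_xpath M N (f : rep_hom M N) m i j (e : j = i + m%:R) (u : M i) :
  f j (xpath e u) = xpath e (f i u).
Proof.
elim: m j e => [|m IH] j e /=; last by rewrite hom_x IH.
by case: _ / (path_end0 e).
Qed.

Lemma hom_ypath M N (f : rep_hom M N) m i j (e : j = i + m%:R) (u : M j) :
  f i (ypath e u) = ypath e (f j u).
Proof.
elim: m i e => [|m IH] i e /=; last by rewrite hom_y IH.
by case: _ / (esym (path_end0 e)).
Qed.

Lemma hom_gen M N (f : rep_hom M N) v j (u : M v) : f j (gen j u) = gen j (f v u).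
Proof. by rewrite /gen; case: ifP => _; rewrite (hom_xpath, hom_ypath). Qed.

Lemma hom_act M N (f : rep_hom M N) i (p : {poly F}) (u : M i) :
  f i (p *: (u : center_mod M i) : center_mod M i) =
  (p *: (f i u : center_mod N i) : center_mod N i).
Proof.
rewrite -[LHS]/(f i (poly_act (rep_t M i) p u)) -[RHS]/(poly_act (rep_t N i) p (f i u)).
apply: poly_act_hom => w.
by rewrite /rep_t /= hom_x hom_y.
Qed.

Section FreeHom.
Variables (T : choiceType) (vx : T -> 'Z_n).
Local Notation P := (free_rep vx).

Section Extend.
Variables (M : rep F n k) (m : forall a, M (vx a)).

Definition free_fun i : {freeg T / {poly F}} -> center_mod M i :=
  fext (fun a => gen i (m a) : center_mod M i).

Fact free_fun_linear i : linear (free_fun i : P i -> M i).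
Proof.
move=> c u v; rewrite -[c *: u]/(c%:P *: (u : {freeg T / {poly F}})).
rewrite /free_fun linearP; congr (_ + _); exact: poly_actC.
Qed.
Lemma free_funE i (p : {poly F}) a :
  free_fun i (p *: fgen _ a) = p *: (gen i (m a) : center_mod M i).
Proof. by rewrite /free_fun linearZ /= fextE. Qed.

Lemma free_funD i : {morph free_fun i : D E / D + E}.
Proof. by move=> D E; rewrite /free_fun linearD. Qed.

Fact free_fun_x j i (e : i = j + 1) (p : P j) :
  free_fun i (qx P e p) = qx M e (free_fun j p).
Proof.
move: p; apply: (@free_ext_add _ _ (M i) (fun p => free_fun i (qx P e p))
  (fun p => qx M e (free_fun j p))) => [D E|D E|p a] /=.
- by rewrite linearD free_funD.
- by rewrite free_funD linearD.
rewrite /restr_map linearZ /= diagE scalerA !free_funE.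
rewrite -scalerA -(gen_x e); symmetry; apply: poly_act_hom => w.
by rewrite rep_t_x.
Qed.

Fact free_fun_y j i (e : i = j + 1) (p : P i) :
  free_fun j (qy P e p) = qy M e (free_fun i p).
Proof.
move: p; apply: (@free_ext_add _ _ (M j) (fun p => free_fun j (qy P e p))
  (fun p => qy M e (free_fun i p))) => [D E|D E|p a] /=.
- by rewrite linearD free_funD.
- by rewrite free_funD linearD.
rewrite /restr_map linearZ /= diagE scalerA !free_funE.
rewrite -scalerA -(gen_y e); symmetry; apply: poly_act_hom => w.
by rewrite rep_t_y.
Qed.

Definition free_hom : rep_hom P M := RepHom free_fun_linear free_fun_x free_fun_y.

Lemma free_homE a : free_hom (vx a) (fgen _ a) = m a.
Proof. by rewrite /= -[fgen _ a]scale1r free_funE scale1r gen_self. Qed.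

End Extend.

Lemma free_act i (p : {poly F}) (D : {freeg T / {poly F}}) :
  (p *: (D : center_mod P i) : center_mod P i) = p *: D.
Proof.
have tX (E : {freeg T / {poly F}}) : rep_t P i E = 'X *: E.
  rewrite (rep_tE (pred_succ i)) /= /restr_map diag_comp.
  move: E; apply: (@free_ext_add _ _ {freeg T / {poly F}}) => [D1 D2|D1 D2|q a].
  - exact: linearD.
  - exact: scalerDr.
  by rewrite linearZ /= diagE rim_xy !scalerA mulrC.
elim/poly_ind: p => [|p c IH]; first by rewrite !scale0r.
rewrite scalerDl [RHS]scalerDl; congr (_ + _); last exact: poly_actC.
by rewrite [LHS]poly_actMX [poly_act _ _ _]IH tX [p * _]mulrC scalerA.
Qed.

Lemma gen_free j a : @gen P (vx a) j (fgen _ a) = fgen _ a.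
Proof.
set v := vx a; pose d := (j - v)%R : nat.
have ed : j = v + d%:R := gen_end v j.
have dn : (d < n)%N by rewrite -[X in (_ < X)%N](Zp_cast hn) ltn_ord.
rewrite /gen; case: leqP => dk.
  rewrite free_xpath diagE big1 ?scale1r // => l _.
  rewrite /rim_x (arc_succ (erefl _) (erefl _)); last first.
    exact: leq_trans (ltn_ord l) (ltnW dn).
  by rewrite (leq_trans (ltn_ord l) dk).
rewrite free_ypath diagE big1 ?scale1r // => l _.
have e : j + l%:R = v + (d + l)%:R by rewrite natrD addrA -ed.
rewrite /rim_y (arc_succ (erefl _) e); last first.
  by rewrite -ltn_subRL; exact: ltn_ord l.
by rewrite ltnNge (leq_trans (ltnW dk)) ?leq_addr.
Qed.

Lemma free_projective : projective P.
Proof.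
move=> M N g f gsurj.
pose m a := projT1 (cid (gsurj (vx a) (f (vx a) (fgen _ a)))).
have mE a : g (vx a) (m a) = f (vx a) (fgen _ a).
  by rewrite /m; case: cid.
exists (free_hom m); apply/rep_homP => i.
apply: (@free_ext_add _ _ (N i)) => [D E|D E|p a].
- exact: linearD.
- exact: linearD.
rewrite /= free_funE hom_act hom_gen mE -hom_gen gen_free.
by rewrite -[p *: fgen _ a](free_act i) hom_act.
Qed.

End FreeHom.

Lemma projective_image M (S : forall i, M i -> Prop) :
  (forall (T : choiceType) (vx : T -> 'Z_n) (m : forall a, M (vx a)) ,
    (forall a, S (vx a) (m a)) -> forall i u, S i (free_hom m i u)) ->
  exists (P : rep F n k) (f : rep_hom P M),
    projective P /\ forall i (w : M i), S i w <-> exists u, f i u = w.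
Proof.
move=> S_closed.
pose T := {classic {i : 'Z_n & {w : M i | S i w}}}.
pose vx (a : T) := projT1 a; pose m (a : T) : M (vx a) := sval (projT2 a).
exists (free_rep vx), (free_hom m); split; first exact: free_projective.
move=> i w; split=> [Sw|[u <-]].
  pose a : T := existT _ i (exist _ w Sw).
  by exists (fgen _ a); exact: (free_homE m a).
by apply: S_closed => a; exact: svalP.
Qed.

Lemma free_hom_comp M N (g : rep_hom M N) (T : choiceType) (vx : T -> 'Z_n)
    (m : forall a, M (vx a)) i u :
  (forall a, g (vx a) (m a) = 0) -> g i (free_hom m i u) = 0.
Proof.
move=> gm; move: u; apply: (@free_ext_add _ _ (N i) _ (fun=> 0)) => [D E|D E|p a].
- by rewrite !linearD.
- by rewrite addr0.
by rewrite /= free_funE hom_act hom_gen gm -(hom_gen (hom_zero N N) i 0) scaler0.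
Qed.

Lemma enough_projectives M :
  exists (P : rep F n k) (f : rep_hom P M), projective P /\ hom_surj f.
Proof.
have [|P [f [Pproj fS]]] := @projective_image M (fun _ _ => True); first by [].
by exists P, f; split=> // i w; apply/fS.
Qed.

Lemma kernel_cover M N (g : rep_hom M N) :
  exists (P : rep F n k) (f : rep_hom P M), projective P /\ exact_at f g.
Proof.
apply: (@projective_image M (fun i (w : M i) => g i w = 0)) => T vx m gm i u.
exact: free_hom_comp.
Qed.

Theorem proj_resolution_exists M : inhabited (proj_resolution M).
Proof.
pose state := {A : rep F n k & {B : rep F n k & rep_hom A B}}.
pose src (s : state) := projT1 s.
pose tgt (s : state) := projT1 (projT2 s).
pose arr (s : state) : rep_hom (src s) (tgt s) := projT2 (projT2 s).
pose good (s : state) (P : rep F n k) (f : rep_hom P (src s)) :=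
  projective P /\ exact_at f (arr s).
have cover (s : state) : {P : rep F n k & {f : rep_hom P (src s) | good s P f}}.
  have [P Pf] := cid (kernel_cover (arr s)); exists P; exact: cid.
pose next (s : state) : state := existT _ (projT1 (cover s))
  (existT _ (src s) (sval (projT2 (cover s)))).
have [P0 [f0 [P0_proj f0_surj]]] := enough_projectives M.
pose st m : state := iter m next (existT _ P0 (existT _ M f0)).
constructor; apply: (@ProjResolution F n k M (fun m => src (st m))
  (fun m => arr (st m.+1)) f0) => //.
- by case=> [|m] //; case: (svalP (projT2 (cover (st m)))).
- by case: (svalP (projT2 (cover (st 0)))).
by move=> m; case: (svalP (projT2 (cover (st m.+1)))).
Qed.

End FreeRepresentations.

(* Main.v *)
From HB Require Import structures.
Require Import Defs.
From mathcomp Require Import all_boot all_order all_algebra perm.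
From mathcomp Require Import boolp freeg zify.

Set Implicit Arguments.
Unset Strict Implicit.
Unset Printing Implicit Defensive.

Import GRing.Theory.
Local Open Scope ring_scope.

(** Write t for 'X, r for the number of peaks of the rim of I (the vertices of
    rim_U I, where L_I needs a generator) and s for the number of boxes.

    The module L_I has a presentation Q1 -> Q0 -> L_I -> 0 in which Q0 has one
    projective summand per peak and Q1 one per valley: the summand at a valley
    v maps its generator to the difference of the two neighbouring peak
    generators, both of which reach the generator of L_I at v.  Exactness
    (pres_exact) is local: as one walks around the circle, the generator of the
    peak that serves the current vertex changes only at valleys, and there the
    change is a boundary.  So modulo boundaries every element x of Q0 is eps x
    times one chosen generator.  A map from Q0 or Q1 to L_J is a vector of
    polynomials, and restriction along Q1 -> Q0 is multiplication by D*
    (Dstar_mulE): the powers of t in D* count the arrows on which the path from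
    a peak to a valley acts on L_J as t.

    Ext^1 is therefore Z / im D*, with Z the vectors that vanish on the kernel
    of Q1 -> Q0 (ext_comparison replaces any resolution by the presentation).
    As L_J is torsion free, Z is saturated.  As L_I maps to Q0 with composite
    L_I -> Q0 -> L_I equal to t^m for some m (pres_section), t^m Z lies in im D*.
    Hence Z / im D* is the torsion of the cokernel of D*, that is the sum of the
    F[t]/(d) over the nonzero invariant factors d, which are powers of t.

    Two ranks remain.  The kernel of D* is Hom(L_I, L_J), which has rank one, so
    there are r - 1 nonzero invariant factors.  The kernel of D* modulo t is
    Hom(L_I, L_J / t): a family of scalars indexed by the circle, constant away
    from the symmetric difference of I and J, zero just before each letter L and
    just after each letter R.  It is determined by its values on the stretches
    that run from an L to an R, of which there are s (vanish_of_drops), so at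
    least r - s of the invariant factors are 1.  This leaves s - 1 of them for
    the exponents h (corank1_torsion_structure). *)

(** * Quotients of modules *)

Lemma mod_iso_of_surj (R : comNzRingType) (A V W : lmodType R)
    (f : A -> V) (g : A -> W) :
  linear f -> linear g ->
  (forall v, exists a, f a = v) -> (forall w, exists a, g a = w) ->
  (forall a, f a = 0 <-> g a = 0) -> mod_iso V W.
Proof.
move=> lf lg fs gs fg.
pose f' : {linear A -> V} := HB.pack f (GRing.isLinear.Build R A V *:%R f lf).
pose g' : {linear A -> W} := HB.pack g (GRing.isLinear.Build R A W *:%R g lg).
have eq a b : f a = f b <-> g a = g b.
  have fB : f (a - b) = f a - f b := linearB f' a b.
  have gB : g (a - b) = g a - g b := linearB g' a b.
  have := fg (a - b); rewrite fB gB => e.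
  by split=> ab; apply/eqP; rewrite -subr_eq0; apply/eqP/e; rewrite ab subrr.
pose u v := g (projT1 (cid (fs v))).
pose w x := f (projT1 (cid (gs x))).
have uE a : u (f a) = g a by rewrite /u; case: cid => b /= /eq.
have wE a : w (g a) = f a by rewrite /w; case: cid => b /= /eq.
have ul : linear u.
  move=> c x y; have [a <-] := fs x; have [b <-] := fs y.
  by rewrite -lf !uE lg.
pose U : {linear V -> W} := HB.pack u (GRing.isLinear.Build R V W *:%R u ul).
exists U; exists w => x.
  by have [a <-] := fs x; rewrite [U _]uE wE.
by have [a <-] := gs x; rewrite wE [U _]uE.
Qed.

Lemma quot_proj_linear (R : comNzRingType) (V : lmodType R) (S : submodClosed V) :
  linear (@quot_proj R V S).
Proof. by move=> c u v; rewrite quot_projD -quot_scaleE. Qed.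

Lemma quot_proj_eq0 (R : comNzRingType) (V : lmodType R) (S : submodClosed V) v :
  @quot_proj R V S v = 0 <-> v \in S.
Proof.
have {1}<- : @quot_proj R V S 0 = 0.
  by apply: (addrI (quot_proj S 0)); rewrite -quot_projD !addr0.
by rewrite quot_projP subr0.
Qed.

(** * Presentations and first extension groups *)

Section Homology.
Variables (F : fieldType) (n k : nat).
Hypotheses (hn : (1 < n)%N) (hkn : (k < n)%N).
Implicit Types M N P Q : rep F n k.

Fact hom_id_linear P i : linear (@idfun (P i)).
Proof. by []. Qed.

Definition hom_id P : rep_hom P P :=
  RepHom (@hom_id_linear P) (fun _ _ _ _ => erefl) (fun _ _ _ _ => erefl).

(** An abstract projective is only known to lift along surjections; it is a
    retract of a free representation, where a lift can be chosen on generators,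
    so it also lifts along maps whose image merely contains that of f. *)
Lemma projective_lift P M N (g : rep_hom M N) (f : rep_hom P N) :
  projective P -> (forall i u, exists w, g i w = f i u) ->
  exists h : rep_hom P M, forall i u, g i (h i u) = f i u.
Proof.
move=> Pproj im.
pose T := {classic {i : 'Z_n & P i}}.
pose vx (a : T) := projT1 a; pose m (a : T) : P (vx a) := projT2 a.
have cov : hom_surj (free_hom hn hkn m).
  move=> i u; pose a : T := existT _ i u.
  by exists (fgen _ a); exact: (free_homE hn hkn m a).
have [s sE] := Pproj _ _ _ (hom_id P) cov.
pose l (a : T) := projT1 (cid (im _ (m a))).
have lE a : g _ (l a) = f _ (m a) by rewrite /l; case: cid.
exists (hom_comp (free_hom hn hkn l) s) => i u /=.
have /rep_homP/(_ i u) /= su := sE.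
rewrite -[in RHS]su; move: (s i u); apply: (@free_ext_add _ _ (N i)) => [D E|D E|p a].
- by rewrite free_funD linearD.
- by rewrite free_funD linearD.
by rewrite !free_funE !hom_act !hom_gen lE.
Qed.

Lemma hom_subE M N (f g : rep_hom M N) i u :
  (f - g : rep_hom M N) i u = f i u - g i u.
Proof. by []. Qed.

(** If the chain map (a1, a0) induces zero on M, then a0 lifts to a homotopy
    h : P0 -> Q1, and a1 and h d differ by a map into the kernel of b, which f
    does not see.  Applied to a difference with the identity it compares
    resolutions; applied to multiplication by a scalar it bounds torsion. *)
Lemma null_homotopy P1 P0 Q1 Q0 M N (d : rep_hom P1 P0) (b : rep_hom Q1 Q0)
    (eps : rep_hom Q0 M) (a1 : rep_hom P1 Q1) (a0 : rep_hom P0 Q0)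
    (f : rep_hom Q1 N) :
  projective P0 -> exact_at b eps ->
  (forall i u, b i (a1 i u) = a0 i (d i u)) ->
  (forall i u, eps i (a0 i u) = 0) ->
  (forall i u, b i u = 0 -> f i u = 0) ->
  exists g : rep_hom P0 N, forall i u, f i (a1 i u) = g i (d i u).
Proof.
move=> P0proj ex ba ea fb.
have [i u|h hE] := @projective_lift _ _ _ b a0 P0proj; first exact/ex/ea.
exists (hom_comp f h) => i u; apply/eqP; rewrite -subr_eq0 -linearB; apply/eqP/fb.
by rewrite linearB /= ba hE subrr.
Qed.

Lemma chain_lift P1 P0 Q1 Q0 M (d : rep_hom P1 P0) (eta : rep_hom P0 M)
    (b : rep_hom Q1 Q0) (eps : rep_hom Q0 M) :
  projective P1 -> projective P0 -> hom_surj eps -> exact_at b eps ->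
  (forall i u, eta i (d i u) = 0) ->
  exists (a1 : rep_hom P1 Q1) (a0 : rep_hom P0 Q0),
    (forall i u, eps i (a0 i u) = eta i u) /\
    (forall i u, b i (a1 i u) = a0 i (d i u)).
Proof.
move=> p1 p0 es ex ed.
have [i u|a0 a0E] := @projective_lift _ _ _ eps eta p0; first exact: es.
have [i u|a1 a1E] := @projective_lift _ _ _ b (hom_comp a0 d) p1.
  by apply/ex; rewrite /= a0E ed.
by exists a1, a0.
Qed.

(** Multiplication by c on the complex Q1 -> Q0 factors, up to homotopy, through
    M when it does so on M itself; the homotopy exhibits c f as a coboundary. *)
Lemma section_torsion Q1 Q0 M N (b : rep_hom Q1 Q0) (eps : rep_hom Q0 M)
    (s : rep_hom M Q0) (c : {poly F}) (f : rep_hom Q1 N) :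
  projective Q0 -> exact_at b eps ->
  (forall i u, eps i (s i u) = (c *: (u : center_mod M i) : center_mod M i)) ->
  (forall i u, b i u = 0 -> f i u = 0) ->
  exists g : rep_hom Q0 N, forall i u, (c *: f) i u = g i (b i u).
Proof.
move=> p0 ex es fb.
have eb i u : eps i (b i u) = 0 by apply/ex; exists u.
have [||//|g gE] := @null_homotopy _ _ _ _ _ _ b b eps (c *: hom_id Q1)
  (c *: hom_id Q0 - hom_comp s eps) f p0 ex.
- move=> i u; rewrite hom_subE /=.
  by rewrite eb linear0 subr0; exact: (hom_act b c u).
- move=> i u; rewrite hom_subE /=.
  by rewrite linearB /= es (hom_act eps c u) subrr.
exists g => i u; rewrite -gE; symmetry; exact: (hom_act f c u).
Qed.

Section Comparison.
Variables (M N Q1 Q0 : rep F n k) (R : proj_resolution M).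
Variables (b : rep_hom Q1 Q0) (eps : rep_hom Q0 M).
Hypotheses (q1 : projective Q1) (q0 : projective Q0) (es : hom_surj eps)
  (ex : exact_at b eps).

Lemma Z1_ker (z : Z1 R N) i u : res_d R 0 i u = 0 -> z i u = 0.
Proof.
case: z => z zP /= /res_exact[v <-].
by have /asboolP/rep_homP/(_ i v) := zP.
Qed.

(** Extensions are the maps from Q1 that vanish on the kernel of b, modulo those
    that extend to Q0.  Composition with a lift t of the identity of M
    carries cocycles of R to such maps, and is bijective modulo coboundaries
    because t has an inverse up to homotopy. *)
Lemma ext_comparison : exists t : rep_hom Q1 (res_obj R 1),
  [/\ forall i u, b i u = 0 -> res_d R 0 i (t i u) = 0,
      forall z : Z1 R N, z \in @coboundary1 _ _ _ _ R N <->
        exists g : rep_hom Q0 N, forall i u, z i (t i u) = g i (b i u)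
    & forall f : rep_hom Q1 N, (forall i u, b i u = 0 -> f i u = 0) ->
      exists (z : Z1 R N) (g : rep_hom Q0 N),
        forall i u, z i (t i u) = f i u + g i (b i u)].
Proof.
have er i u : res_aug R i (res_d R 0 i u) = 0 by apply/res_exact0; exists u.
have eb i u : eps i (b i u) = 0 by apply/ex; exists u.
have [f1 [f0 [f0E f1E]]] := chain_lift (@res_proj _ _ _ _ R 1) (@res_proj _ _ _ _ R 0) es ex er.
have [t1 [t0 [t0E t1E]]] := chain_lift q1 q0 (@res_surj _ _ _ _ R) (@res_exact0 _ _ _ _ R) eb.
exists t1; split=> [i u bu|z|f fb].
- by rewrite t1E bu linear0.
- split=> [/asboolP[g zg]|[g zg]].
    exists (hom_comp g t0) => i u /=; rewrite -t1E.
    by have /= -> := zg.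
  have [||//|h hE] := @null_homotopy _ _ _ _ _ _ (res_d R 0) _ _
      (hom_comp t1 f1 - hom_id _) (hom_comp t0 f0 - hom_id _) z
      (@res_proj _ _ _ _ R 0) (@res_exact0 _ _ _ _ R).
  + move=> i u; rewrite hom_subE /=.
    by rewrite linearB /= t1E f1E.
  + move=> i u; rewrite hom_subE /=.
    by rewrite linearB /= t0E f0E subrr.
  + exact: Z1_ker.
  apply/asboolP; exists (hom_comp g f0 - h); apply/rep_homP => i u.
  have := hE i u; rewrite hom_subE /= linearB /= zg f1E.
  move=> e; rewrite -[RHS]/(g i (f0 i (res_d R 0 i u)) - h i (res_d R 0 i u)).
  by rewrite -e opprB addrC subrK.
have zP : hom_comp f f1 \in @cocycle1 _ _ _ _ R N.
  apply/asboolP/rep_homP => i u /=; apply: fb; rewrite f1E.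
  have -> : res_d R 0 i (res_d R 1 i u) = 0 by apply/res_exact; exists u.
  exact: linear0.
have [||//|h hE] := @null_homotopy _ _ _ _ _ _ b _ _
      (hom_comp f1 t1 - hom_id _) (hom_comp f0 t0 - hom_id _) f q0 ex.
- move=> i u; rewrite hom_subE /=.
  by rewrite linearB /= f1E t1E.
- move=> i u; rewrite hom_subE /=.
  by rewrite linearB /= f0E t0E subrr.
exists (MkZ1 zP), h => i u /=; rewrite -hE.
by rewrite hom_subE /= linearB /= addrC subrK.
Qed.

End Comparison.

End Homology.

(** * The Smith normal form of a polynomial matrix *)

Section Equiv.
Variable R : comUnitRingType.

(** Two-sided equivalence, which preserves the invariant factors. *)
Definition mx_equiv m n (A B : 'M[R]_(m, n)) : Prop :=
  exists L S, [/\ L \in unitmx, S \in unitmx & L *m A *m S = B].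

Lemma mx_equiv_refl m n (A : 'M[R]_(m, n)) : mx_equiv A A.
Proof. by exists 1%:M, 1%:M; rewrite !unitmx1 mul1mx mulmx1. Qed.

Lemma mx_equiv_trans m n (A B C : 'M[R]_(m, n)) :
  mx_equiv A B -> mx_equiv B C -> mx_equiv A C.
Proof.
move=> [L [S [uL uS <-]]] [L' [S' [uL' uS' <-]]].
by exists (L' *m L), (S *m S'); rewrite !unitmx_mul uL uS uL' uS' !mulmxA.
Qed.

Lemma mx_equiv_lower m1 m2 n (X : 'M[R]_(m2, m1)) (U : 'M[R]_(m1, n)) D :
  mx_equiv (col_mx U D) (col_mx U (X *m U + D)).
Proof.
exists (block_mx 1%:M 0 X 1%:M), 1%:M; split; rewrite ?unitmx1 //.
  by rewrite unitmxE det_lblock !det1 mulr1 unitr1.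
by rewrite mulmx1 mul_block_col !mul1mx mul0mx addr0.
Qed.

Lemma mx_equiv_upper m1 m2 n (X : 'M[R]_(m1, m2)) (U : 'M[R]_(m1, n)) D :
  mx_equiv (col_mx U D) (col_mx (U + X *m D) D).
Proof.
exists (block_mx 1%:M X 0 1%:M), 1%:M; split; rewrite ?unitmx1 //.
  by rewrite unitmxE det_ublock !det1 mulr1 unitr1.
by rewrite mulmx1 mul_block_col !mul1mx mul0mx add0r.
Qed.

Lemma mx_equiv_tr m n (A B : 'M[R]_(m, n)) : mx_equiv A B -> mx_equiv A^T B^T.
Proof.
move=> [L [S [uL uS <-]]]; exists S^T, L^T; rewrite !unitmx_tr !trmx_mul.
by rewrite mulmxA.
Qed.

Lemma mx_equiv_block m n (a : R) (A B : 'M[R]_(m, n)) :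
  mx_equiv A B -> mx_equiv (block_mx a%:M 0 0 A : 'M_(1 + m, 1 + n)) (block_mx a%:M 0 0 B).
Proof.
move=> [L [S [uL uS <-]]]; exists (block_mx 1%:M 0 0 L), (block_mx 1%:M 0 0 S).
split; rewrite ?unitmxE ?det_ublock ?det1 ?mul1r //.
by rewrite !mulmx_block !(mul0mx, mulmx0, mul1mx, mulmx1, addr0, add0r).
Qed.

Lemma mx_equivZ m n (a : R) (A B : 'M[R]_(m, n)) :
  mx_equiv A B -> mx_equiv (a *: A) (a *: B).
Proof.
by move=> [L [S [uL uS <-]]]; exists L, S; rewrite -scalemxAr -scalemxAl.
Qed.

End Equiv.

Section Smith.
Variable F : fieldType.
Implicit Types (m n : nat) (p : {poly F}).

Definition corner m n (M : 'M[{poly F}]_(1 + m, 1 + n)) := M (lshift m 0) (lshift n 0).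

(** The pivot is an entry of least degree among all the matrices equivalent to M,
    so that any division with remainder that produced a smaller entry would
    contradict its choice; no descent on degrees is then needed. *)
Lemma min_entry m n (M : 'M[{poly F}]_(1 + m, 1 + n)) : M != 0 ->
  exists N, [/\ mx_equiv M N, corner N \is monic &
    forall N' i j, mx_equiv M N' -> N' i j != 0 -> (size (corner N) <= size (N' i j))%N].
Proof.
move=> nzM.
pose P s := `[< exists N i j, [/\ mx_equiv M N, N i j != 0 & size (N i j) = s] >].
have exP : exists s, P s.
  have /matrix0Pn[i [j nz]] := nzM.
  by exists (size (M i j)); apply/asboolP; exists M, i, j; split=> //; exact: mx_equiv_refl.
case: (ex_minnP exP) => s /asboolP[N [i [j [MN nzN sN]]]] smin.
pose c := (lead_coef (N i j))^-1.
have nzc : c != 0 by rewrite invr_eq0 lead_coef_eq0.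
pose N1 := c%:P *: xrow i (lshift m 0) (xcol j (lshift n 0) N).
have N1E : corner N1 = c *: N i j by rewrite /corner !mxE !tpermR mul_polyC.
exists N1; split.
- apply: mx_equiv_trans MN _.
  exists (c%:P *: tperm_mx i (lshift m 0)), (tperm_mx j (lshift n 0)); split.
  + by rewrite unitmxZ ?unitmx_perm // poly_unitE size_polyC nzc coefC /= unitfE.
  + exact: unitmx_perm.
  by rewrite -!scalemxAl /N1 xrowE xcolE mulmxA.
- by rewrite N1E monicE lead_coefZ mulVf // lead_coef_eq0.
move=> N' i' j' MN' nz'; rewrite N1E size_scale // sN; apply: smin.
by apply/asboolP; exists N', i', j'.
Qed.

(** Subtracting a multiple of the first row leaves the remainder of the division
    by the pivot, which minimality forces to vanish. *)
Lemma min_entry_dvd_col m n (M N : 'M[{poly F}]_(1 + m, 1 + n)) :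
  mx_equiv M N ->
  (forall N' i j, mx_equiv M N' -> N' i j != 0 -> (size (corner N) <= size (N' i j))%N) ->
  corner N != 0 ->
  forall i, corner N %| N i (lshift n 0).
Proof.
move=> MN Nmin nz i; case: (split_ordP i) => [i0 ->|i1 ->]; first by rewrite ord1 dvdpp.
pose X := \col_i (- (N (rshift 1 i) (lshift n 0) %/ corner N)) : 'cV[{poly F}]_m.
have MN' : mx_equiv M (col_mx (usubmx N) (X *m usubmx N + dsubmx N)).
  by apply: mx_equiv_trans (mx_equiv_lower _ _ _); rewrite vsubmxK.
apply/negPn/negP; rewrite /dvdp => nz'.
have e : (col_mx (usubmx N) (X *m usubmx N + dsubmx N)) (rshift 1 i1) (lshift n 0) =
   N (rshift 1 i1) (lshift n 0) %% corner N.
  rewrite col_mxEd !mxE big_ord1 !mxE mulNr addrC.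
  by apply/eqP; rewrite subr_eq addrC; exact/eqP/divp_eq.
have := Nmin _ (rshift 1 i1) (lshift n 0) MN'; rewrite e -size_poly_eq0 in nz' *.
by move/(_ nz'); rewrite leqNgt ltn_modp nz.
Qed.

Lemma min_entry_dvd_row m n (M N : 'M[{poly F}]_(1 + m, 1 + n)) :
  mx_equiv M N ->
  (forall N' i j, mx_equiv M N' -> N' i j != 0 -> (size (corner N) <= size (N' i j))%N) ->
  corner N != 0 ->
  forall j, corner N %| N (lshift m 0) j.
Proof.
move=> MN Nmin nz j.
have := @min_entry_dvd_col _ _ M^T N^T (mx_equiv_tr MN); rewrite /corner !mxE.
move=> /(_ _ nz j); rewrite mxE; apply=> N' i' j' MN' nz'.
have := Nmin N'^T j' i'; rewrite mxE; apply=> //.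
by rewrite -[M]trmxK; apply: mx_equiv_tr.
Qed.

Definition smith_mx m n (d : seq {poly F}) : 'M[{poly F}]_(m, n) :=
  \matrix_(i, j) (d`_i *+ (i == j :> nat)).

(** Once the first row and column are cleared, adding any other row to the first
    one and using minimality again shows that the pivot divides the whole
    remaining block. *)
Lemma smith_split m n (M : 'M[{poly F}]_(1 + m, 1 + n)) : M != 0 ->
  exists (a : {poly F}) (B : 'M[{poly F}]_(m, n)),
    a \is monic /\ mx_equiv M (block_mx a%:M 0 0 (a *: B)).
Proof.
move=> /min_entry[N [MN mon Nmin]]; have nz := monic_neq0 mon.
have dc := min_entry_dvd_col MN Nmin nz; have dr := min_entry_dvd_row MN Nmin nz.
set a := corner N in mon nz Nmin dc dr.
pose X := \col_i (- (N (rshift 1 i) (lshift n 0) %/ a)) : 'cV[{poly F}]_m.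
pose Y := \row_i (- (N (lshift m 0) (rshift 1 i) %/ a)) : 'rV[{poly F}]_n.
pose C := X *m ursubmx N + drsubmx N.
have MN1 : mx_equiv M (block_mx a%:M 0 0 C).
  apply: mx_equiv_trans MN _.
  exists (block_mx 1%:M 0 X 1%:M), (block_mx 1%:M Y 0 1%:M); split.
  - by rewrite unitmxE det_lblock !det1 mulr1 unitr1.
  - by rewrite unitmxE det_ublock !det1 mulr1 unitr1.
  rewrite -[N in LHS](@submxK _ 1 m 1 n) !mulmx_block.
  rewrite !(mul0mx, mulmx0, mul1mx, mulmx1, addr0, add0r).
  have e1 : ulsubmx N = a%:M by rewrite [ulsubmx _]mx11_scalar !mxE.
  have e2 : X *m ulsubmx N + dlsubmx N = 0.
    apply/matrixP => i j; rewrite e1 mul_mx_scalar !mxE ord1 mulrN mulrC.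
    by rewrite divpK ?dc // addNr.
  have e3 : ulsubmx N *m Y + ursubmx N = 0.
    apply/matrixP => i j; rewrite e1 mul_scalar_mx !mxE ord1 mulrN mulrC.
    by rewrite divpK ?dr // addNr.
  by rewrite e2 e3 e1 mul0mx add0r.
exists a, (map_mx (fun c => c %/ a) C); split=> //.
suff dC i j : a %| C i j.
  have -> // : a *: map_mx (fun c => c %/ a) C = C.
  by apply/matrixP => i j; rewrite 2!mxE mulrC divpK // dC.
pose N2 : 'M[{poly F}]_(1 + m, 1 + n) := block_mx a%:M (row i C) 0 C.
have MN2 : mx_equiv M N2.
  apply: mx_equiv_trans MN1 _.
  have := mx_equiv_upper (delta_mx 0 i) (row_mx a%:M 0 : 'M_(1, 1 + n)) (row_mx 0 C).
  by rewrite mul_mx_row mulmx0 add_row_mx addr0 add0r -rowE -!block_mxEv.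
have e0 : corner N2 = a by rewrite /corner block_mxEul mxE.
have := min_entry_dvd_row MN2; rewrite e0 => /(_ Nmin nz (rshift 1 j)).
by rewrite block_mxEur mxE.
Qed.

Lemma Smith_normal_form m n (M : 'M[{poly F}]_(m, n)) :
  exists d, invariant_factors M d.
Proof.
suff [d [sd md dd Md]] : exists d, [/\ (size d <= minn m n)%N,
    all (fun x => x \is monic) d, sorted (@dvdp F) d & mx_equiv M (smith_mx m n d)].
  by exists d; split.
elim: m n M => [|m IH] n M.
  by exists [::]; split; rewrite ?min0n //; rewrite [M]flatmx0 [smith_mx _ _ _]flatmx0; exact: mx_equiv_refl.
case: n M => [|n] M.
  by exists [::]; split; rewrite ?minn0 //; rewrite [M]thinmx0 [smith_mx _ _ _]thinmx0; exact: mx_equiv_refl.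
have [->|nz] := eqVneq M 0.
  exists [::]; split=> //; have -> : smith_mx m.+1 n.+1 [::] = 0.
    by apply/matrixP => i j; rewrite !mxE nth_nil mul0rn.
  exact: mx_equiv_refl.
have [a [B [mon MB]]] := smith_split nz.
have [d [sd md dd Bd]] := IH n B.
exists (a :: [seq a * x | x <- d]); split.
- by rewrite /= size_map minnSS.
- by rewrite /= mon all_map; apply: sub_all md => x mx /=; rewrite monicMl.
- case: d dd {sd md Bd} => //= x d dd; rewrite dvdp_mulr //=.
  by rewrite path_map; apply: sub_path dd => y z /= yz; rewrite dvdp_mul2l ?monic_neq0.
apply: mx_equiv_trans MB _.
have -> : smith_mx m.+1 n.+1 (a :: [seq a * x | x <- d]) =
   block_mx a%:M 0 0 (a *: smith_mx m n d) :> 'M_(1 + m, 1 + n).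
  apply/matrixP => i j; rewrite mxE.
  case: (split_ordP i) => [i' ->|i' ->]; case: (split_ordP j) => [j' ->|j' ->].
  - by rewrite block_mxEul !ord1 mxE.
  - by rewrite block_mxEur !ord1 mxE.
  - by rewrite block_mxEdl !ord1 mxE.
  rewrite block_mxEdr !mxE /= mulrnAr; congr (_ *+ _).
  have [lt|ge] := ltnP i' (size d); first by rewrite (nth_map 0).
  by rewrite !nth_default ?size_map ?mulr0.
exact/mx_equiv_block/mx_equivZ.
Qed.

End Smith.

(** * Torsion cokernels of corank one *)

Section Core.
Variable F : fieldType.

Lemma ker_exists m n (M : 'M[F]_(m, n)) : (m < n)%N ->
  exists c : 'cV_n, c != 0 /\ M *m c = 0.
Proof.
move=> mn; have : kermx M^T != 0.
  rewrite kermx_eq0 /row_free mxrank_tr neq_ltn.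
  by rewrite (leq_ltn_trans (rank_leq_row M) mn).
move=> /rowV0Pn[v /sub_kermxP vM nz]; exists v^T; split; first by rewrite trmx_eq0.
by apply: trmx_inj; rewrite trmx_mul trmxK trmx0.
Qed.

Lemma smith_mulE m n (d : seq {poly F}) (y : 'cV_n) (i : 'I_m) (j : 'I_n) :
  i = j :> nat -> (smith_mx m n d *m y) i 0 = d`_i * y j 0.
Proof.
move=> ij; rewrite mxE (bigD1 j) //= !mxE ij eqxx mulr1n big1 ?addr0 // => l lj.
by rewrite !mxE ij [(_ == _ :> nat)]eq_sym -val_eqE /= in lj *; rewrite (negPf lj) mul0r.
Qed.

Lemma smith_mul0 m n (d : seq {poly F}) (y : 'cV_n) (i : 'I_m) :
  (n <= i)%N -> (smith_mx m n d *m y) i 0 = 0.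
Proof.
move=> ni; rewrite mxE big1 // => l _; rewrite !mxE.
case: eqVneq => [e|_]; last by rewrite mul0r.
by rewrite e leqNgt ltn_ord in ni.
Qed.

(** Equivalence carries the image of D to that of a diagonal matrix, where
    membership is divisibility in each coordinate; the coordinates beyond the
    last invariant factor fall under the default value 0, that is they vanish. *)
Lemma smith_image p q (D : 'M[{poly F}]_(p, q)) d L S z : (size d <= minn p q)%N ->
  L \in unitmx -> S \in unitmx -> L *m D *m S = smith_mx p q d ->
  (exists f : 'cV_q, D *m f = z) <-> forall i : 'I_p, d`_i %| (L *m z) i 0.
Proof.
move=> sd uL uS LDS; split=> [[f <-] i|dvd].
  have -> : L *m (D *m f) = smith_mx p q d *m (invmx S *m f).
    by rewrite -LDS -!mulmxA mulKVmx.
  have [iq|qi] := ltnP i q; first by rewrite (@smith_mulE _ _ _ _ i (Ordinal iq)) ?dvdp_mulr.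
  by rewrite smith_mul0.
pose y := \col_(j < q) (if insub (j : nat) is Some i then (L *m z) i 0 %/ d`_j else 0).
exists (S *m y); apply: (can_inj (mulKmx uL)); rewrite !mulmxA LDS.
apply/matrixP => i j; rewrite ord1 {j}.
have [iq|qi] := ltnP i q.
  rewrite (@smith_mulE _ _ _ _ i (Ordinal iq)) // mxE /= (insubT (fun x => x < p)%N (ltn_ord i)).
  have -> : Sub (i : nat) (ltn_ord i) = i :> 'I_p by apply: val_inj.
  by rewrite mulrC divpK.
rewrite smith_mul0 //; apply/esym/eqP; rewrite -dvd0p.
by have := dvd i; rewrite nth_default // (leq_trans sd) // geq_min qi orbT.
Qed.

Lemma monic_dvd_Xn (d : {poly F}) N : d \is monic -> d %| 'X^N -> exists h, d = 'X^h.
Proof.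
move=> dm; rewrite -['X]subr0 -polyC0 => /dvdp_exp_XsubCP[h _].
rewrite polyC0 subr0 => dX; exists h; apply/eqP; rewrite -eqp_monic ?monicXn //.
Qed.

Lemma dvdp_Xn a b : ('X^a %| ('X^b : {poly F})) = (a <= b)%N.
Proof.
apply/idP/idP => [/dvdp_leq|/subnK <-]; last by rewrite exprD dvdp_mull.
by rewrite -size_poly_eq0 !size_polyXn ltnS => ->.
Qed.

(** The setting abstracts D* from its origin: Z is the module of cocycles, D_ker
    and D_sing say that the kernel of D has rank one, and D_mod that the kernel
    of D modulo 'X has dimension at most s, as it is detected by the s
    coordinates sel. *)
Variables (p q s N : nat) (D : 'M[{poly F}]_(p, q)) (Z : 'cV[{poly F}]_p -> Prop).
Variables (j0 : 'I_q) (sel : 'I_s -> 'I_q).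
Hypothesis Z_im : forall f : 'cV_q, Z (D *m f).
Hypothesis Z_sat : forall (c : {poly F}) z, c != 0 -> Z (c *: z) -> Z z.
Hypothesis Z_tors : forall z, Z z -> exists f, D *m f = 'X^N *: z.
Hypothesis D_ker : forall f : 'cV_q, D *m f = 0 -> f j0 0 = 0 -> f = 0.
Hypothesis D_sing : exists f : 'cV_q, f != 0 /\ D *m f = 0.
Hypothesis D_mod : forall f : 'cV_q, (forall i : 'I_p, 'X %| (D *m f) i 0) ->
  (forall i : 'I_s, 'X %| f (sel i) 0) -> forall j : 'I_q, 'X %| f j 0.
Hypothesis sq : (s <= q)%N.

(** The columns of S beyond the size of d span the kernel of D, which is of rank
    one: D_sing provides one such column, and two of them would be proportional
    by D_ker, since suitable multiples agree in the coordinate j0. *)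
Lemma smith_size d L S : all (fun x => x \is monic) d -> (size d <= minn p q)%N ->
  L \in unitmx -> S \in unitmx -> L *m D *m S = smith_mx p q d -> size d = q.-1.
Proof.
move=> md sd uL uS LDS; have sdq : (size d <= q)%N by rewrite (leq_trans sd) ?geq_minr.
have sdp : (size d <= p)%N by rewrite (leq_trans sd) ?geq_minl.
have kerE y : smith_mx p q d *m y = 0 -> D *m (S *m y) = 0.
  by move=> e; apply: (can_inj (mulKmx uL)); rewrite mulmx0 !mulmxA LDS.
have col0 (j : 'I_q) : (size d <= j)%N -> smith_mx p q d *m (delta_mx j 0 : 'cV_q) = 0.
  move=> dj; rewrite -colE; apply/matrixP => i l; rewrite !mxE.
  by case: eqP => // ->; rewrite nth_default.
have q0 : (0 < q)%N := leq_ltn_trans (leq0n _) (ltn_ord j0).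
apply/eqP; have -> : (size d == q.-1) = ((size d < q) && (q <= (size d).+1))%N.
  by rewrite eqn_leq -[in RHS](prednK q0) !ltnS.
apply/andP; split.
  rewrite ltn_neqAle sdq andbT; apply/eqP => dq.
  have [f [/negP fnz Df]] := D_sing; apply: fnz.
  have := mulKVmx uS f; set y := invmx S *m f => Sy.
  have y0 : y = 0.
    apply/matrixP => j l; rewrite ord1 [RHS]mxE {l}.
    have jp : (j < p)%N by rewrite (leq_trans _ sdp) // dq.
    have : (smith_mx p q d *m y) (Ordinal jp) 0 = 0.
      by rewrite -LDS -[_ *m y]mulmxA Sy -mulmxA Df mulmx0 mxE.
    rewrite (@smith_mulE _ _ _ _ _ j) // => /eqP; rewrite mulf_eq0 => /orP[/eqP e|/eqP//].
    have := all_nthP 0 md j; rewrite dq ltn_ord => /(_ isT).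
    by rewrite [d`_j]e monicE lead_coef0 eq_sym oner_eq0.
  by rewrite -Sy y0 mulmx0.
rewrite leqNgt; apply/negP => dq; have dq1 : (size d < q)%N := ltnW dq.
pose a := Ordinal dq1; pose b := Ordinal dq.
pose f := S *m (delta_mx a 0 : 'cV_q); pose g := S *m (delta_mx b 0 : 'cV_q).
have Df : D *m f = 0 by apply/kerE/col0.
have Dg : D *m g = 0 by apply/kerE/col0/leqnSn.
have : g j0 0 *: f - f j0 0 *: g = 0.
  apply: D_ker; first by rewrite linearB /= -!scalemxAr Df Dg !scaler0 subr0.
  by rewrite !mxE mulrC subrr.
rewrite !scalemxAr -mulmxBr => /(congr1 (mulmx (invmx S))).
rewrite mulKmx // mulmx0 => e.
have ab : (a == b) = false by rewrite -val_eqE /= ltn_eqF.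
have Dg0 := D_ker Dg; move: (g j0 0) (f j0 0) e Dg0 => x y e.
have := congr1 (fun M : 'cV_q => M a 0) e; rewrite !mxE !eqxx /= ab.
rewrite mulr1 mulr0 subr0 => -> /(_ erefl)/(congr1 (mulmx (invmx S))).
rewrite mulKmx // mulmx0 => /matrixP/(_ b 0)/eqP.
by rewrite !mxE !eqxx oner_eq0.
Qed.

(** The vector z with L z the i-th basis vector has a multiple in the image of D,
    so it lies in Z by saturation, and 'X^N kills its class: hence the i-th
    factor divides 'X^N. *)
Lemma smith_factors_Xn d L S : all (fun x => x \is monic) d -> (size d <= minn p q)%N ->
  L \in unitmx -> S \in unitmx -> L *m D *m S = smith_mx p q d ->
  forall x, x \in d -> exists h, x = 'X^h.
Proof.
move=> md sd uL uS LDS x xd; apply: (@monic_dvd_Xn _ N); first exact: (allP md).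
have [i id <-] := nthP 0 xd; have ip : (i < p)%N by rewrite (leq_trans id) // (leq_trans sd) ?geq_minl.
pose z := invmx L *m (delta_mx (Ordinal ip) 0 : 'cV_p).
have im := smith_image _ sd uL uS LDS.
have [f Df] : exists f, D *m f = d`_i *: z.
  apply/im => l; rewrite -scalemxAr mulKVmx // !mxE eqxx andbT -val_eqE /=.
  by case: eqVneq => [->|]; rewrite ?mulr1 ?dvdpp // mulr0 dvdp0.
have Zz : Z z.
  apply: (@Z_sat d`_i); last by rewrite -Df.
  exact/monic_neq0/(allP md)/mem_nth.
have /im/(_ (Ordinal ip)) := Z_tors Zz.
by rewrite -scalemxAr mulKVmx // !mxE !eqxx mulr1.
Qed.

(** If 'X divided the factors with index m or more and m < q - s, the last q - m
    columns of S (the last of which lies in the kernel of D) would be killed by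
    D modulo 'X.  There are more than s of them, so some combination over F
    vanishes at the s coordinates sel; by D_mod it vanishes modulo 'X, against
    the invertibility of S.  The case m = q - 1, where nothing is assumed
    of the factors, gives 0 < s. *)
Lemma smith_unit_factors d L S : size d = q.-1 -> (size d <= minn p q)%N ->
  L \in unitmx -> S \in unitmx -> L *m D *m S = smith_mx p q d ->
  (0 < s)%N /\ forall m, (forall j, (m <= j < q.-1)%N -> 'X %| d`_j) -> (q - s <= m)%N.
Proof.
move=> sd sd' uL uS LDS.
have q0 : (0 < q)%N := leq_ltn_trans (leq0n _) (ltn_ord j0).
suff main m : (m <= q.-1)%N -> (forall j, (m <= j < q.-1)%N -> 'X %| d`_j) -> (q - s <= m)%N.
  split=> [|m].
    rewrite lt0n; apply/eqP => s0.
    have : (q - s <= q.-1)%N.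
      by apply: main => // j /andP[h1 h2]; rewrite ltnNge h1 in h2.
    by rewrite s0 subn0 leqNgt ltn_predL q0.
  have [mq|qm] := leqP m q.-1; first exact: main.
  by move=> _; rewrite (leq_trans (leq_subr _ _)) // -(prednK q0).
move=> mq dX; rewrite leqNgt; apply/negP => msq.
have smq : (s < q - m)%N by rewrite ltn_subRL addnC -ltn_subRL.
have bnd (l : 'I_(q - m)) : (m + l < q)%N by rewrite -ltn_subRL.
pose e (l : 'I_(q - m)) : 'I_q := Ordinal (bnd l).
pose C : 'M[F]_(s, q - m) := \matrix_(i, l) (S (sel i) (e l)).[0].
(* the coefficients c are constants, so divisibility by 'X means that they vanish *)
have [c [nzc Cc]] := ker_exists C smq.
pose y : 'cV[{poly F}]_q := \sum_l (c l 0)%:P *: delta_mx (e l) 0.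
have XE (g : {poly F}) : ('X %| g) = (g.[0] == 0).
  by rewrite -['X]subr0 -polyC0 dvdp_XsubCl rootE.
have lowy (j : 'I_q) : (j < m)%N -> y j 0 = 0.
  move=> jm; rewrite summxE big1 // => l _; rewrite !mxE eqxx andbT -val_eqE /=.
  by rewrite ltn_eqF ?mulr0 // (leq_trans jm) ?leq_addr.
have yE l : y (e l) 0 = (c l 0)%:P.
  rewrite summxE (bigD1 l) //= !mxE !eqxx mulr1 big1 ?addr0 // => l' ll'.
  rewrite !mxE eqxx andbT -val_eqE /= eqn_add2l eq_sym val_eqE (negPf ll').
  by rewrite mulr0.
have Sy0 : forall j : 'I_q, 'X %| (S *m y) j 0.
  apply: D_mod => i.
    have -> : D *m (S *m y) = invmx L *m (smith_mx p q d *m y).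
      by rewrite -LDS -!mulmxA mulKmx.
    rewrite mxE (big_ind (fun g => 'X %| g)) ?dvdp0 // => [u v|l _]; first exact: dvdp_add.
    apply: dvdp_mull; have [lq|ql] := ltnP l q; last by rewrite smith_mul0 ?dvdp0.
    rewrite (@smith_mulE _ _ _ _ l (Ordinal lq)) //.
    have [lm|ml] := ltnP l m; first by rewrite lowy // mulr0 dvdp0.
    have [lq1|ql1] := ltnP l q.-1; first by rewrite dvdp_mulr // dX ?ml.
    by rewrite nth_default ?sd // mul0r dvdp0.
  rewrite XE; apply/eqP; have /matrixP/(_ i 0) := Cc.
  rewrite mxE [RHS]mxE => Cc0; rewrite mxE -[RHS]Cc0.
  rewrite horner_sum (bigID (fun j : 'I_q => (j < m)%N)) /= big1 ?add0r => [|j jm]; last first.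
    by rewrite lowy // mulr0 horner0.
  rewrite (reindex_onto e (fun j => insubd (Ordinal (leq_ltn_trans (leq0n s) smq)) (j - m)%N)) /=.
    rewrite [LHS](eq_bigl xpredT) => [|l].
      by apply: eq_bigr => l _; rewrite !mxE hornerM yE hornerC.
    rewrite -leqNgt leq_addr /=; apply/eqP/val_inj => /=.
    by rewrite val_insubd addKn ltn_ord.
  move=> j; rewrite -leqNgt => mj; apply: val_inj; rewrite /= val_insubd.
  by rewrite ltn_sub2r ?subnKC // (leq_ltn_trans mj).
have y0 j : 'X %| y j 0.
  rewrite -(mulKmx uS y) mxE (big_ind (fun g => 'X %| g)) ?dvdp0 // => [u v|l _].
    exact: dvdp_add.
  exact: dvdp_mull.
case/negP: nzc; apply/eqP/matrixP => l l'; rewrite ord1 mxE.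
by have := y0 (e l); rewrite yE XE hornerC => /eqP.
Qed.

(** Z is cut out by the coordinates of L z that the image of D cannot reach, as it
    contains that image with torsion quotient and is saturated.  The quotient is
    thus read off the remaining coordinates, those of the factors equal to 1
    contributing nothing. *)
Theorem corank1_torsion_structure : exists h : s.-1.-tuple nat,
  [/\ sorted leq h,
      invariant_factors D (nseq (q - s) 1 ++ [seq 'X^e | e <- h]),
      (q - s + s.-1 <= p)%N &
      exists2 L, L \in unitmx &
        (forall z, Z z <-> forall i : 'I_p, (q - s + s.-1 <= i)%N -> (L *m z) i 0 = 0) /\
        (forall z, Z z -> (exists f, D *m f = z) <->
           forall (j : 'I_s.-1) (i : 'I_p), i = (q - s + j)%N :> nat ->
             'X^(tnth h j) %| (L *m z) i 0)].
Proof.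
have [d ivd] := Smith_normal_form D.
have [sd md dd [L [S [uL uS LDS]]]] := ivd.
have szd := smith_size md sd uL uS LDS.
have pw := smith_factors_Xn md sd uL uS LDS.
have [s0 un] := smith_unit_factors szd sd uL uS LDS.
pose ex (x : {poly F}) := (size x).-1.
have exE x : x \in d -> x = 'X^(ex x).
  by case/pw => h ->; rewrite /ex size_polyXn.
pose m := (q - s)%N; pose hh := [seq ex x | x <- d].
have dhh : d = [seq 'X^e | e <- hh].
  by rewrite -map_comp -[LHS]map_id; apply/eq_in_map => x /exE.
have shh : sorted leq hh.
  move: dd; rewrite {1}dhh sorted_map; apply: sub_sorted => a b /=.
  by rewrite dvdp_Xn.
have szh : size hh = q.-1 by rewrite size_map.
have q0 : (0 < q)%N := leq_ltn_trans (leq0n _) (ltn_ord j0).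
have ms : (m + s.-1 = q.-1)%N by rewrite -subn1 addnBA // subnK // subn1.
have unit0 j : (j < m)%N -> hh`_j = 0%N.
  move=> jm; apply/eqP; rewrite -leqn0 leqNgt; apply/negP => hj.
  suff : (m <= j)%N by rewrite leqNgt jm.
  apply: un => l /andP[jl lq].
  rewrite dhh (nth_map 0%N) ?szh // -['X]expr1 dvdp_Xn (leq_trans hj) //.
  by apply: (sorted_leq_nth leq_trans leqnn 0%N shh); rewrite ?inE ?szh // (leq_ltn_trans jl).
have szdr : size (drop m hh) == s.-1.
  by rewrite size_drop szh -ms addKn.
pose h := Tuple szdr.
have dE : d = nseq m 1 ++ [seq 'X^e | e <- h].
  rewrite dhh -[in LHS](cat_take_drop m hh) map_cat; congr (_ ++ _).
  apply: (@eq_from_nth _ 0); first by rewrite size_map size_takel ?size_nseq // szh -ms leq_addr.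
  rewrite size_map size_takel => [i im|]; last by rewrite szh -ms leq_addr.
  rewrite nth_nseq im (nth_map 0%N) ?nth_take //; last by rewrite size_takel // szh -ms leq_addr.
  by rewrite unit0.
have qp : (q.-1 <= p)%N by rewrite -szd (leq_trans sd) ?geq_minl.
exists h; split.
- exact: drop_sorted.
- by rewrite -dE.
- by rewrite ms.
exists L => //; have im := smith_image _ sd uL uS LDS.
have ZE z : Z z <-> forall i : 'I_p, (q - s + s.-1 <= i)%N -> (L *m z) i 0 = 0.
  rewrite ms; split=> [/Z_tors[f Df] i qi|Lz].
    have /im/(_ i) : exists f, D *m f = 'X^N *: z by exists f.
    rewrite nth_default ?szd // dvd0p -scalemxAr mxE mulf_eq0.
    by rewrite expf_eq0 polyX_eq0 andbF => /eqP.
  (* any common multiple of the invariant factors will do *)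
  pose c := 'X^(\sum_(x <- hh) x)%N : {poly F}.
  apply: (@Z_sat c); first by rewrite expf_eq0 polyX_eq0 andbF.
  have /im[f <-] : forall i : 'I_p, d`_i %| (L *m (c *: z)) i 0; last exact: Z_im.
  move=> i; rewrite -scalemxAr mxE; have [iq|qi] := ltnP i q.-1; last first.
    by rewrite Lz // mulr0 dvdp0.
  rewrite dvdp_mulr // dhh (nth_map 0%N) ?szh // dvdp_Xn (big_nth 0%N) big_mkord.
  by rewrite (bigD1 (Ordinal (etrans (congr1 (leq i.+1) szh) iq))) //= leq_addr.
split=> // z Zz; apply: (iff_trans (im z)); split=> [dv j i ij|dv i].
  have := dv i; rewrite dE nth_cat size_nseq ij ltnNge leq_addr /= addKn.
  by rewrite (tnth_nth 0%N) (nth_map 0%N) // (eqP szdr).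
have [im'|mi] := ltnP i m; first by rewrite dE nth_cat size_nseq im' nth_nseq im' dvd1p.
have [iq|qi] := ltnP i q.-1; last by rewrite ((ZE z).1 Zz) ?dvdp0 // ms.
have ims : (i - m < s.-1)%N by rewrite ltn_subLR // ms.
have := dv (Ordinal ims) i; rewrite /= subnKC // => /(_ erefl).
rewrite (tnth_nth 0%N) dE nth_cat size_nseq ltnNge mi /=.
by rewrite (nth_map 0%N) // (eqP szdr).
Qed.

End Core.

(** * Cyclic words *)

Section Words.
Implicit Types (b c : bool) (w : seq bool) (ls : seq (option bool)).

Definition drops b w : nat := count id (pairmap (fun a c => a && ~~ c) b w).

(** The running value of a word with gaps: a gap keeps the previous letter. *)
Definition carry b (o : option bool) := odflt b o.

(** A gap repeats the previous letter, hence creates no fall. *)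
Lemma drops_scanl b ls : drops b (scanl carry b ls) = drops b (pmap id ls).
Proof.
rewrite /drops; elim: ls b => //= [[c|]] ls IH b /=; first by rewrite IH.
by rewrite andbN add0n.
Qed.

Lemma foldl_carry b ls : foldl carry b ls = last b (pmap id ls).
Proof. by elim: ls b => //= [[c|]] ls IH b /=. Qed.

(** Around a circle, falls and rises alternate, so half of the changes are falls. *)
Lemma size_collapse w :
  size (cyclic_collapse w) = (drops (last false w) w).*2.
Proof.
rewrite /cyclic_collapse size_map size_filter.
(* along an open word, rises minus falls is the difference between the end values *)
have main b u : (count (fun p => p.1 != p.2) (zip u (belast b u)) + b
    = (drops b u).*2 + last b u)%N.
  rewrite /drops; elim: u b => //= c u IH b.
  apply/eqP; rewrite doubleD -[in X in _ == X]addnA -IH.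
  move: (count _ _) => x; apply/eqP.
  by case: b; case: c; rewrite /= ?add0n ?addn0 ?addn1 ?addSn ?add0n.
case/lastP: w => // u z; rewrite last_rcons -[RHS](addnK z).
have := main z (rcons u z); rewrite last_rcons => <-; rewrite addnK.
by rewrite belast_rcons rotr1_rcons.
Qed.

End Words.

Section Circle.
Variable n : nat.
Implicit Types (i j x : 'Z_n) (A I J : {set 'Z_n}).
Local Notation N := (Zp_trunc n).+2.

(** The order of the representatives agrees with the cyclic order, except at the
    passage from n - 1 to 0. *)
Lemma Zp_pred i : (i = 0 /\ (i - 1 : 'Z_n) = N.-1 :> nat) \/ i = (i - 1)%R.+1 :> nat.
Proof.
have e : (i : nat) = (((i - 1)%R).+1 %% N)%N.
  by rewrite -{1}(subrK 1 i) /= modnDmr addn1.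
have := ltn_ord (i - 1); rewrite leq_eqVlt => /orP[/eqP h|h].
  by left; split; [apply: val_inj; rewrite /= {1}e h modnn | exact: (congr1 predn h)].
by right; rewrite {1}e modn_small.
Qed.

Lemma Zp_add_inj i (l m : nat) : (l < N)%N -> (m < N)%N ->
  i + l%:R = i + m%:R -> l = m.
Proof.
move=> lN mN /addrI/(congr1 val) /=.
by rewrite !Zp_nat /= !modn_small.
Qed.

Lemma Zp_add_onto i x : exists2 l, (l < N)%N & i + l%:R = x.
Proof. by exists (x - i); rewrite ?ltn_ord // natr_Zp addrC subrK. Qed.

Lemma circle_ind (P : 'Z_n -> Prop) i : P i -> (forall j, P j -> P (j + 1)) -> forall j, P j.
Proof.
move=> Pi PS j; have [l _ <-] := Zp_add_onto i j.
by elim: l => [|l IH]; rewrite ?addr0 // -natr1 addrA; apply: PS.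
Qed.

Lemma circle_ind_pred (P : 'Z_n -> Prop) i : P i -> (forall j, P j -> P (j - 1)) -> forall j, P j.
Proof.
move=> Pi PS j; rewrite -[j]opprK; move: (- j); apply: (@circle_ind _ (- i)).
  by rewrite opprK.
by move=> l Pl; rewrite opprD; apply: PS.
Qed.

(** A function on the circle with sum zero is a difference of consecutive values
    of a potential; adding the total of g keeps the partial sums nonnegative. *)
Lemma circle_potential (f g : 'Z_n -> nat) :
  (\sum_i f i = \sum_i g i)%N ->
  exists c : 'Z_n -> nat, forall i, (c i + g i = c (i - 1)%R + f i)%N.
Proof.
move=> fg; pose G := (\sum_i g i)%N.
pose S h i := (\sum_(j : 'Z_n | j <= i) h j)%N.
have SG i : (S g i <= G)%N by rewrite /G [leqRHS](bigID (fun j : 'Z_n => (j <= i)%N)) leq_addr.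
exists (fun i => G + S f i - S g i)%N => i.
have SS h (j : 'Z_n) : (i : nat) = j.+1 -> S h i = (S h j + h i)%N.
  move=> e; rewrite /S (bigD1 i) //= addnC; congr (_ + _)%N.
  by apply: eq_bigl => l; rewrite -(inj_eq val_inj) /= e; lia.
have Sge j : (S g j <= G + S f j)%N by rewrite (leq_trans (SG j)) ?leq_addr.
case: (Zp_pred i) => [[i0 im]|e]; last first.
  have := SG (i - 1); have := SG i; rewrite !(SS _ _ e); lia.
have S0 h : S h i = h i.
  by rewrite /S (big_pred1 i) // => j; rewrite /= i0 -(inj_eq val_inj) /= leqn0.
have SN h : S h (i - 1) = (\sum_j h j)%N.
  by apply: eq_bigl => j; rewrite im -ltnS ltn_ord.
by rewrite !S0 !SN fg addnK subnK // (leq_trans _ (leq_addr _ _)) // -S0 SG.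
Qed.

(** The letter read at i, with true for L and false for R as in LR_word, and a gap
    where I and J agree. *)
Definition letter I J i : option bool :=
  if (i \in I) (+) (i \in J) then Some (i \in J) else None.

(** lab i is the last letter read up to i.  Going around the circle, lab falls
    exactly when an L is followed by an R, so the boxes can be counted on the
    circle itself instead of in the collapsed word. *)
Lemma last_letter I J : exists lab : 'Z_n -> bool,
  (forall i, lab i = carry (lab (i - 1)) (letter I J i)) /\
  num_boxes I J = #|[set i | lab (i - 1) && ~~ lab i]|.
Proof.
pose ls := map (letter I J) (enum 'Z_n).
have wE : LR_word I J = pmap id ls.
  rewrite /LR_word /ls; elim: (enum 'Z_n) => //= x e IH.
  by rewrite [letter I J x]/letter; case: ifP => /= _; rewrite IH.
pose b0 := last false (LR_word I J).
pose lab i := foldl carry b0 (take i.+1 ls).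
have szls : size ls = N by rewrite size_map size_enum_ord.
have nth_ls i : nth None ls i = letter I J i.
  by rewrite (nth_map i) ?size_enum_ord // nth_ord_enum.
have labN i : i = N.-1 :> nat -> lab i = b0.
  move=> iN; rewrite /lab iN prednK // take_oversize ?szls // foldl_carry -wE.
  by rewrite /b0; case: (LR_word I J).
have labS i : lab i = carry (lab (i - 1)) (letter I J i).
  rewrite {1}/lab (take_nth None) ?szls ?ltn_ord // foldl_rcons nth_ls.
  congr carry; case: (Zp_pred i) => [[-> im]|e]; last by rewrite e.
  by rewrite take0 labN // im.
exists lab; split=> //.
rewrite /num_boxes size_collapse doubleK -/b0 wE -drops_scanl /drops.
rewrite -sum1_card -sum1_count (big_nth false) size_pairmap size_scanl szls big_mkord.
rewrite big_mkcond [RHS]big_mkcond; apply: eq_bigr => i _ /=; rewrite inE.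
have nl (j : 'Z_n) : nth false (scanl carry b0 ls) j = lab j.
  by rewrite nth_scanl // szls ltn_ord.
rewrite (nth_pairmap false) ?size_scanl ?szls ?ltn_ord // nl.
congr (if _ then _ else _); congr (_ && _).
case: (Zp_pred i) => [[-> im]|e]; first by rewrite (labN _ im).
by rewrite e; exact: nl.
Qed.

Section Letters.
Variables (I J : {set 'Z_n}) (lab : 'Z_n -> bool).
Hypothesis labE : forall i, lab i = carry (lab (i - 1)) (letter I J i).
Local Notation T := [set i | lab (i - 1) && ~~ lab i].

(** The label can only fall at an element of I, and can only rise outside I.  So
    between two falls the circle leaves I and comes back.  The indicator Phi of
    the states where such an entrance into I has occurred and has not yet been
    used by a fall turns this into an inequality between local terms, which is
    summed around the circle. *)
Lemma card_drops_le : (#|T| <= #|rim_U I|)%N.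
Proof.
have -> : #|rim_U I| = #|[set i | (i - 1 \notin I) && (i \in I)]|.
  rewrite -(card_imset _ (addIr (1 : 'Z_n))); apply: eq_card => i; rewrite inE.
  apply/imsetP/idP => [[u]|iI]; first by rewrite inE => h ->; rewrite addrK.
  by exists (i - 1); rewrite ?inE subrK.
pose Phi i : nat := (i \in I) && lab i.
have shift : (\sum_i Phi (i - 1)%R = \sum_i Phi i)%N.
  by rewrite [RHS](reindex_inj (addIr (- 1 : 'Z_n))).
rewrite -(leq_add2r (\sum_i Phi i)) -[in leqRHS]shift -!sum1_card.
rewrite [X in (X + _)%N]big_mkcond [X in (_ <= X + _)%N]big_mkcond -!big_split.
apply: leq_sum => i _; rewrite !inE /Phi (labE i) /letter.
by case: (i \in I); case: (i \in J); case: (lab (i - 1)); case: (i - 1 \in I).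
Qed.

Hypothesis IJ : I <> J.

Lemma diff_exists : exists x, (x \in I) (+) (x \in J).
Proof.
apply: contrapT => /forallNP e; apply: IJ; apply/setP => x.
by have := e x; case: (x \in I); case: (x \in J) => //= /(_ isT).
Qed.

(** A failure of P at i propagates across gaps, forwards if the last letter is L
    and backwards if it is R.  In that direction the first letter met would be an
    L ahead, an R ahead making lab fall, or an R behind: places where P holds.
    So no letter is met all the way around, but I and J differ somewhere. *)
Lemma vanish_of_drops (P : 'Z_n -> Prop) :
  (forall i, i \in I -> i \notin J -> P i) ->
  (forall i, i \notin I -> i \in J -> P (i - 1)) ->
  (forall i, (i \in I) = (i \in J) -> P i <-> P (i - 1)) ->
  (forall i, i \in T -> P (i - 1)) -> forall i, P i.
Proof.
move=> PR PL PN PT i; apply: contrapT => nPi; have [x dx] := diff_exists.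
case li : (lab i).
  suff all : forall j, ~ P j /\ (lab j /\ ~~ ((j + 1 \in I) (+) (j + 1 \in J))).
    by have [_ [_]] := all (x - 1); rewrite subrK dx.
  have step j : ~ P j -> lab j -> ~~ ((j + 1 \in I) (+) (j + 1 \in J)).
    move=> nPj lj; apply/negP; have := PR (j + 1); have := PL (j + 1); have := PT (j + 1).
    rewrite !inE addrK lj /= labE addrK /letter.
    by case: (_ \in I); case: (_ \in J) => //= h1 h2 h3 _; apply: nPj; auto.
  apply: (@circle_ind _ i) => [|j [nPj [lj sj]]]; first by rewrite li; auto.
  have nPj1 : ~ P (j + 1).
    by rewrite PN ?addrK //; move: sj; case: (_ \in I); case: (_ \in J).
  have lj1 : lab (j + 1) by rewrite labE addrK /letter (negPf sj).
  by auto.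
suff all : forall j, ~ P j /\ (~~ lab j /\ ~~ ((j \in I) (+) (j \in J))).
  by have [_ [_]] := all x; rewrite dx.
have step j : ~ P j -> ~~ lab j -> ~~ ((j \in I) (+) (j \in J)).
  move=> nPj; rewrite labE /letter; have := PR j.
  by case: (_ \in I); case: (_ \in J) => //= h _; case: nPj; auto.
apply: (@circle_ind_pred _ i) => [|j [nPj [lj sj]]].
  by split=> //; split; [rewrite li | apply: step; rewrite ?li].
have nPj1 : ~ P (j - 1).
  by rewrite -PN //; move: sj; case: (_ \in I); case: (_ \in J).
have lj1 : ~~ lab (j - 1) by move: lj; rewrite labE /letter (negPf sj).
by auto.
Qed.

End Letters.

(** The run of elements of A at the start of an injective enumeration g of the
    circle ends at an element outside A, and has length at most the size of A.
    It is used with g going forwards and backwards. *)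
Lemma run_exists (g : nat -> 'Z_n) A x :
  (forall l m, (l < N)%N -> (m < N)%N -> g l = g m -> l = m) ->
  (forall y, exists2 l, (l < N)%N & g l = y) -> x \notin A ->
  exists d, [/\ (d <= #|A|)%N, g d \notin A & forall l, (l < d)%N -> g l \in A].
Proof.
move=> ginj gonto xA.
have ex : exists d, (d < N)%N && (g d \notin A).
  by have [l lN gl] := gonto x; exists l; rewrite lN gl.
case: (ex_minnP ex) => d /andP[dN gd] dmin; exists d.
have gA l : (l < d)%N -> g l \in A.
  move=> ld; apply/negPn/negP => gl; have := dmin l.
  by rewrite (ltn_trans ld dN) gl leqNgt ld => /(_ isT).
split=> //; rewrite -[d]card_ord -(card_in_imset (f := fun l : 'I_d => g l)).
  by apply/subset_leq_card/subsetP => y /imsetP[l _ ->]; apply: gA.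
move=> l m _ _ /ginj e; apply/val_inj/e; exact: ltn_trans (ltn_ord _) dN.
Qed.

End Circle.

(** * Peaks and valleys of a rim *)

Section Peaks.
Variable n : nat.
Variables (I : {set 'Z_n}) (x0 x1 : 'Z_n).
Hypotheses (x0I : x0 \in I) (x1I : x1 \notin I).
Implicit Types (i u v : 'Z_n) (A : {set 'Z_n}).

(** u is the peak of the rim on whose slope i lies: the one before i along x-arrows
    if i is in I, and the one after i along y-arrows (possibly i itself)
    otherwise. *)
Definition peak_spec i u : Prop :=
  if i \in I then exists d, [/\ i = u + d%:R, u \notin I &
    forall l, (l < d)%N -> i - l%:R \in I]
  else exists d, [/\ u = i + d%:R, u + 1 \in I &
    forall l, (l <= d)%N -> i + l%:R \notin I].

Lemma Zp_sub_inj i (l m : nat) : (l < (Zp_trunc n).+2)%N -> (m < (Zp_trunc n).+2)%N ->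
  i - l%:R = i - m%:R -> l = m.
Proof. by move=> lN mN /addrI/oppr_inj e; apply: (@Zp_add_inj n 0); rewrite ?e. Qed.

Lemma Zp_sub_onto i (x : 'Z_n) : exists2 l, (l < (Zp_trunc n).+2)%N & i - l%:R = x.
Proof.
have [l lN e] := Zp_add_onto x i; exists l => //.
by rewrite -e addrK.
Qed.

Lemma peak_exists i : exists u, peak_spec i u.
Proof.
rewrite /peak_spec; case iI : (i \in I).
  have [d [_ dI dmin]] := run_exists (@Zp_sub_inj i) (@Zp_sub_onto i) x1I.
  by exists (i - d%:R), d; rewrite subrK.
have x0C : x0 \notin ~: I by rewrite inE negbK.
have [[|d] [_]] := run_exists (@Zp_add_inj _ i) (@Zp_add_onto _ i) x0C.
  by rewrite addr0 inE iI.
rewrite inE negbK => dI dmin; exists (i + d%:R), d; split=> //.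
  by rewrite -addrA natr1.
by move=> l ld; have := dmin l ld; rewrite inE.
Qed.

Lemma peak_unique i u u' : peak_spec i u -> peak_spec i u' -> u = u'.
Proof.
rewrite /peak_spec; case: ifP => iI [d [e uI dm]] [d' [e' uI' dm']].
  have eu : i - d%:R = u by rewrite e addrK.
  have eu' : i - d'%:R = u' by rewrite e' addrK.
  rewrite -eu -eu'; case: (ltngtP d d') => [/dm'|/dm|-> //].
    by rewrite eu (negPf uI).
  by rewrite eu' (negPf uI').
rewrite e e'; case: (ltngtP d d') => [/dm'|/dm|-> //].
  by rewrite -natr1 addrA -e uI.
by rewrite -natr1 addrA -e' uI'.
Qed.

Definition peak i : 'Z_n := projT1 (cid (peak_exists i)).

Lemma peakP i : peak_spec i (peak i).
Proof. by rewrite /peak; case: cid. Qed.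

Lemma peakE i u : peak_spec i u -> peak i = u.
Proof. exact/peak_unique/peakP. Qed.

Lemma peak_rim i : peak i \in rim_U I.
Proof.
rewrite inE; move: (peakP i); move: (peak i) => u; rewrite /peak_spec.
case: ifP => iI [d [e uI dm]].
  rewrite uI; case: d e dm => [e|d e dm]; first by rewrite e addr0 (negPf uI) in iI.
  by have := dm d (leqnn _); rewrite e -natr1 addrA addrAC addrK.
by rewrite uI andbT e dm.
Qed.

Lemma peak_id u : u \in rim_U I -> peak u = u.
Proof.
rewrite inE => /andP[uI uI1]; apply: peakE; rewrite /peak_spec (negPf uI).
by exists 0%N; rewrite addr0; split=> // l; rewrite leqn0 => /eqP->; rewrite addr0.
Qed.

Lemma peak_in i : i \in I -> peak i = peak (i - 1).
Proof.
move=> iI; have [jI|jI] := boolP (i - 1 \in I); last first.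
  rewrite [peak (i - 1)]peak_id ?inE ?jI ?subrK //; apply: peakE.
  rewrite /peak_spec iI; exists 1%N; rewrite subrK; split=> // l.
  by rewrite ltnS leqn0 => /eqP->; rewrite subr0.
apply: peakE; have := peakP (i - 1); rewrite /peak_spec iI jI => -[d [e uI dm]].
exists d.+1; split=> //; first by rewrite -natr1 addrA -e subrK.
by case=> [|l] ld; rewrite ?subr0 // -nat1r opprD addrA dm.
Qed.

Lemma peak_notin i : i \notin I -> i - 1 \notin I -> peak i = peak (i - 1).
Proof.
move=> iI jI; apply/esym/peakE; have := peakP i; rewrite /peak_spec (negPf iI) (negPf jI).
move=> -[d [e uI dm]]; exists d.+1; split=> //; first by rewrite -nat1r addrA subrK.
by case=> [|l] ld; rewrite ?addr0 // -nat1r addrA subrK dm.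
Qed.

Lemma peak_run_in i : i \in I -> exists d, (0 < d <= #|I|)%N /\ i = peak i + d%:R.
Proof.
move=> iI; have [d [dI gd dm]] := run_exists (@Zp_sub_inj i) (@Zp_sub_onto i) x1I.
exists d; rewrite dI andbT; split.
  by rewrite lt0n; apply/eqP => d0; rewrite d0 subr0 iI in gd.
have /peakE -> : peak_spec i (i - d%:R); last by rewrite subrK.
by rewrite /peak_spec iI; exists d; rewrite subrK.
Qed.

Lemma peak_run_notin i : i \notin I -> exists d, (d < #|~: I|)%N /\ peak i = i + d%:R.
Proof.
move=> iI; have x0C : x0 \notin ~: I by rewrite inE negbK.
have [[|d] [dI]] := run_exists (@Zp_add_inj _ i) (@Zp_add_onto _ i) x0C.
  by rewrite addr0 inE iI.
rewrite inE negbK => d1 dm; exists d; split=> //; apply: peakE.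
rewrite /peak_spec (negPf iI); exists d; split=> //; first by rewrite -addrA natr1.
by move=> l ld; have := dm l ld; rewrite inE.
Qed.

(** The projective at peak i has rim (peak i, peak i + k], which agrees with I at i
    because a slope is not longer than the set, or complement, containing it.
    Hence the arrows between i - 1 and i act alike on that projective and on L_I. *)
Lemma peak_arc i : (0 < (i - peak i)%R <= #|I|)%N = (i \in I).
Proof.
have cI : (#|I| + #|~: I|)%N = (Zp_trunc n).+2 by rewrite cardsC card_ord.
case iI : (i \in I).
  have [d [/andP[d0 dI] e]] := peak_run_in iI.
  have -> : i - peak i = d%:R by rewrite {1}e addrAC subrr add0r.
  have : (0 < #|~: I|)%N by apply/card_gt0P; exists x1; rewrite inE.
  move=> c0; rewrite Zp_nat /= modn_small; first by rewrite d0 dI.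
  by move: cI dI c0; move: #|I| #|~: I| => a b; lia.
have [d [dI ->]] := peak_run_notin (negbT iI).
have N0 : (Zp_trunc n).+2%:R = 0 :> 'Z_n by rewrite Zp_nat; apply: val_inj; rewrite /= modnn.
rewrite opprD addrA subrr add0r; case: d dI => [|d] dI; first by rewrite oppr0.
have dN : (d.+2 <= (Zp_trunc n).+2)%N by move: cI dI; lia.
have -> : - d.+1%:R = ((Zp_trunc n).+2 - d.+1)%:R :> 'Z_n.
  by rewrite natrB ?N0 ?sub0r // ltnW.
rewrite Zp_nat /= modn_small; last by rewrite ltn_subrL.
by apply/negP => /andP[_]; move: cI dI; move: #|I| #|~: I| => a b; lia.
Qed.

Lemma mem_cyc_interval u (l d : nat) : (l < (Zp_trunc n).+2)%N -> (d < (Zp_trunc n).+2)%N ->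
  (u + l%:R \in cyc_interval u (u + d%:R)) = (0 < l <= d)%N.
Proof. by move=> lN dN; rewrite inE ![u + _]addrC !addrK !Zp_nat /= !modn_small. Qed.

Lemma card_cyc_interval A u d : (d < (Zp_trunc n).+2)%N ->
  #|A :&: cyc_interval u (u + d%:R)| = (\sum_(l < d) (u + l%:R + 1 \in A)%R)%N.
Proof.
move=> dN; rewrite -sum1_card big_mkcond (reindex_inj (addrI u)) /=.
pose f (l : nat) : nat := (u + l%:R \in A) && (0 < l <= d)%N.
rewrite (eq_bigr (fun l : 'I_(Zp_trunc n).+2 => f l)) => [|l _]; last first.
  rewrite /f in_setI; have := mem_cyc_interval u (ltn_ord l) dN; rewrite natr_Zp => ->.
  by case: ifP.
rewrite big_ord_recl /f ltnn andbF add0n.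
rewrite (big_ord_widen (Zp_trunc n).+1 (fun l => (u + l%:R + 1 \in A)%R : nat)) //.
rewrite [RHS]big_mkcond; apply: eq_bigr => l _; rewrite lift0 /= -natr1 addrA.
by case: ltnP => _; rewrite ?andbT ?andbF.
Qed.

Lemma precedes_peak u v : u \in rim_U I -> v \in rim_V I ->
  precedes I u v = (u == peak v).
Proof.
move=> uU; rewrite inE => /andP[vI _].
have u'U := peak_rim v; have := peakP v; move: u'U; move: (peak v) => u' u'U.
rewrite /peak_spec vI => -[d [vd u'I dm]].
have [e eN ve] := Zp_add_onto u v.
have uI : u \notin I by move: uU; rewrite inE => /andP[].
have de : (d <= e)%N.
  rewrite leqNgt; apply/negP => /dm; rewrite -ve addrK.
  by apply/negP.
have u'E : u' = u + (e - d)%:R by rewrite natrB // addrA ve vd addrK.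
rewrite /precedes; apply/eqP/eqP => [c0|uu'].
  have : u' \notin cyc_interval u v :&: rim_U I by rewrite c0 inE.
  rewrite in_setI u'U andbT u'E -ve mem_cyc_interval ?leq_subr ?(leq_ltn_trans (leq_subr _ _)) //.
  by rewrite andbT -leqNgt leqn0 => /eqP->; rewrite addr0.
apply/setP => x; rewrite in_setI [RHS]inE; apply/negP => /andP[].
have [l lN <-] := Zp_add_onto u x; rewrite -ve mem_cyc_interval // => /andP[l0 le].
have ed : (e - d = 0)%N.
  apply: (@Zp_add_inj n u); rewrite ?(leq_ltn_trans (leq_subr _ _)) //.
  by rewrite -u'E addr0.
have -> : u + l%:R = v - (e - l)%:R by rewrite natrB // opprB addrA addrAC -ve addrK.
rewrite inE dm //; move: l0 le de ed; lia.
Qed.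

Lemma follows_peak u v : u \in rim_U I -> v \in rim_V I ->
  follows I u v = (u == peak (v + 1)).
Proof.
move=> uU; rewrite inE => /andP[vI v1I].
have u'U := peak_rim (v + 1); have := peakP (v + 1); move: u'U; move: (peak (v + 1)) => u' u'U.
rewrite /peak_spec (negPf v1I) => -[d [vd u'I dm]].
have [e eN ve] := Zp_add_onto v u.
have /andP[uI u1I] : (u \notin I) && (u + 1 \in I) by move: uU; rewrite inE.
have de : (d < e)%N.
  rewrite ltnNge; apply/negP => /dm; rewrite addrAC ve.
  by rewrite u1I.
have u'E : u' = v + d.+1%:R by rewrite vd -nat1r addrA.
rewrite /follows; apply/eqP/eqP => [c0|uu'].
  have : u' \in cyc_interval v u :&: rim_U I.
    by rewrite in_setI u'U andbT u'E -ve mem_cyc_interval // (leq_ltn_trans de).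
  by rewrite c0 inE => /eqP.
have ed : (e = d.+1)%N.
  by apply: (@Zp_add_inj n v); rewrite ?(leq_ltn_trans de) // ve uu' u'E.
apply/setP => x; rewrite in_setI [RHS]inE; apply/idP/eqP => [/andP[]|->]; last first.
  by rewrite uU andbT -ve mem_cyc_interval // ed /=.
have [l lN <-] := Zp_add_onto v x; rewrite -ve mem_cyc_interval // => /andP[l0 le].
rewrite inE => /andP[_ xI]; congr (_ + _%:R); apply/eqP; rewrite eqn_leq le ed /=.
rewrite ltnNge; apply/negP => /dm; rewrite addrAC.
by rewrite xI.
Qed.

End Peaks.

(** * Morphisms into rank one modules *)

Section HomLinear.
Variables (F : fieldType) (n k : nat) (M N : rep F n k) (f : rep_hom M N) (i : 'Z_n).

Lemma hom0 : f i 0 = 0. Proof. exact: linear0. Qed.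
Lemma homN u : f i (- u) = - f i u. Proof. exact: linearN. Qed.
Lemma homD u v : f i (u + v) = f i u + f i v. Proof. exact: linearD. Qed.
Lemma homB u v : f i (u - v) = f i u - f i v. Proof. exact: linearB. Qed.

End HomLinear.

Section RankOneMaps.
Variables (F : fieldType) (n k : nat).
Hypotheses (hn : (1 < n)%N) (hkn : (k < n)%N).
Implicit Types (I J : {set 'Z_n}) (i j : 'Z_n) (p : {poly F}).

Lemma rim_x_exp I i : rim_x F I i = 'X^(i \notin I).
Proof. by rewrite /rim_x; case: ifP. Qed.

Lemma rim_x_neq0 I i : rim_x F I i != 0.
Proof. by rewrite rim_x_exp expf_eq0 polyX_eq0 andbF. Qed.

(** The condition for multiplication by al i at each vertex i to be a morphism from
    L_I to L_J, as far as the x-arrows are concerned. *)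
Definition rim_map I J (al : 'Z_n -> {poly F}) : Prop :=
  forall i, al i * rim_x F I i = rim_x F J i * al (i - 1).

(** The y-arrows come for free: x y = t, and multiplication by t is injective. *)
Lemma rim_map_y I J al : rim_map I J al ->
  forall i, al (i - 1) * rim_y F I i = rim_y F J i * al i.
Proof.
move=> alx i; apply: (mulfI (rim_x_neq0 J i)).
by rewrite !mulrA -alx rim_xy -mulrA rim_xy mulrC.
Qed.

(** Equal cardinalities make the exponents close up around the circle. *)
Lemma rim_map_exists I J : #|I| = #|J| ->
  exists c : 'Z_n -> nat, rim_map I J (fun i => 'X^(c i)).
Proof.
move=> IJ.
have sumC (K : {set 'Z_n}) : (\sum_i (i \notin K : nat) = #|~: K|)%N.
  by rewrite -sum1_card [RHS]big_mkcond; apply: eq_bigr => i _; rewrite inE; case: (i \in K).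
have [|c cE] := @circle_potential n (fun i => i \notin J) (fun i => i \notin I).
  by rewrite !sumC; apply: (@addnI #|I|); rewrite {1}IJ !cardsC.
by exists c => i; rewrite !rim_x_exp -!exprD cE addnC.
Qed.

Section Act.
Variables (J : {set 'Z_n}) (hJ : #|J| = k).
Local Notation N := (rank1 F hn hJ).

Lemma rank1_act i p (u : N i) : (p *: (u : center_mod N i) : center_mod N i) = p * u :> {poly F}.
Proof.
elim/poly_ind: p => [|p c IH]; first by rewrite scale0r mul0r.
rewrite scalerDl mulrDl; congr (_ + _); last first.
  by rewrite [LHS]poly_actC mul_polyC.
rewrite [LHS]poly_actMX [poly_act _ _ _]IH /= /poly_mul mulrA rim_xy.
by rewrite mulrA (mulrC p).
Qed.

Lemma rank1_gen v j : exists c : {poly F}, forall u : N v, gen hn j u = c * u :> {poly F}.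
Proof.
rewrite /gen; case: ((j - v)%R <= k)%N.
  by eexists => u; exact: (@rank1_xpath F n J).
by eexists => u; exact: (@rank1_ypath F n J).
Qed.

Section FromFree.
Variables (T : choiceType) (vx : T -> 'Z_n).
Local Notation P := (free_rep F hn hkn vx).

Lemma hom_free_scale M (f : rep_hom P M) i p (D : {freeg T / {poly F}}) :
  f i (p *: D) = (p *: (f i D : center_mod M i) : center_mod M i).
Proof. by rewrite -(free_act hn hkn vx i) hom_act. Qed.

Lemma free_hom_eta M (f : rep_hom P M) i u :
  f i u = free_hom hn hkn (fun a => f (vx a) (fgen _ a)) i u.
Proof.
move: u; apply: (@free_ext_add _ _ (M i)) => [D E|D E|p a].
- exact: linearD.
- exact: linearD.
by rewrite !hom_free_scale -{1}[fgen _ a](gen_free F hn hkn vx i) hom_gen /= -[in RHS](scale1r (fgen _ a)) free_funE scale1r.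
Qed.

Lemma free_hom_ext M (f g : rep_hom P M) :
  (forall a, f (vx a) (fgen _ a) = g (vx a) (fgen _ a)) -> forall i u, f i u = g i u.
Proof.
move=> fg i u; rewrite free_hom_eta [RHS]free_hom_eta; congr (hom_fun (free_hom hn hkn _) u).
by apply/functional_extensionality_dep.
Qed.

Lemma free_hom_rank1Z (c : {poly F}) (m : T -> {poly F}) i u :
  free_hom hn hkn (vx := vx) (M := N) (fun a => c * m a) i u =
  c * free_hom hn hkn (vx := vx) (M := N) m i u :> {poly F}.
Proof.
rewrite -(rank1_act c (free_hom hn hkn (vx := vx) (M := N) m i u)).
apply: (@free_hom_ext N _ (c *: free_hom hn hkn (vx := vx) (M := N) m)) => a.
rewrite free_homE -[RHS]/((c *: (free_hom hn hkn (vx := vx) (M := N) m (vx a) (fgen _ a) : center_mod N _)) : {poly F}).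
by rewrite rank1_act free_homE.
Qed.

Lemma free_hom_rank1_dvd (c : {poly F}) (m : T -> {poly F}) i u :
  (forall a, c %| m a) -> c %| (free_hom hn hkn (vx := vx) (M := N) m i u : {poly F}).
Proof.
move=> dv; have -> : m = (fun a => c * (m a %/ c)).
  by apply/functional_extensionality_dep => a; rewrite mulrC divpK.
by rewrite free_hom_rank1Z dvdp_mulr.
Qed.

End FromFree.
End Act.
End RankOneMaps.

(** * The presentation of a rank one module *)

Section Presentation.
Variables (F : fieldType) (n k : nat).
Hypotheses (hn : (1 < n)%N) (hkn : (k < n)%N).
Variables (I : {set 'Z_n}) (hI : #|I| = k) (x0 x1 : 'Z_n).
Hypotheses (x0I : x0 \in I) (x1I : x1 \notin I).
Implicit Types (i j : 'Z_n).
Local Notation pk := (peak x0I x1I).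
Local Notation U := (rim_U I).
Local Notation V := (rim_V I).

Definition valley_vertex (c : 'I_#|V|) : 'Z_n := enum_val c.
Definition peak_vertex (a : 'I_#|U|) : 'Z_n := enum_val a.
Definition peak_idx i : 'I_#|U| := enum_rank_in (peak_rim x0I x1I i) (pk i).

Lemma peak_vertexK i : peak_vertex (peak_idx i) = pk i.
Proof. by rewrite /peak_vertex /peak_idx enum_rankK_in ?peak_rim. Qed.

Lemma peak_idx_eq i j : pk i = pk j -> peak_idx i = peak_idx j.
Proof. by move=> e; apply: enum_val_inj; rewrite -!/(peak_vertex _) !peak_vertexK. Qed.

Lemma peak_idxK a : peak_idx (peak_vertex a) = a.
Proof.
apply: enum_val_inj; rewrite -!/(peak_vertex _) peak_vertexK peak_id //.
exact: enum_valP.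
Qed.

Definition peak_free := free_rep F hn hkn peak_vertex.
Definition valley_free := free_rep F hn hkn valley_vertex.
Local Notation fg := (fgen {poly F}).
(** The chosen generator of the peak projectives at vertex i.  All the vertices of
    a free representation carry the same free module, in which the generator of
    a summand stands for its shortest path to i. *)
Definition peak_gen i : {freeg 'I_#|U| / {poly F}} := fg (peak_idx i).

Definition pres_eps : rep_hom peak_free (rank1 F hn hI) :=
  free_hom hn hkn (vx := peak_vertex) (M := rank1 F hn hI) (fun=> 1 : {poly F}).
Definition pres_d : rep_hom valley_free peak_free :=
  free_hom hn hkn (vx := valley_vertex) (M := peak_free)
    (fun c => peak_gen (valley_vertex c) - peak_gen (valley_vertex c + 1)).

Lemma mem_arc_peak i : (i \in Defs.arc k (pk i)) = (i \in I).
Proof. by rewrite inE -hI peak_arc. Qed.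

Lemma peak_free_x j i (e : i = j + 1) (p : {poly F}) a :
  qx peak_free e (p *: fg a) = p *: (rim_x F (Defs.arc k (peak_vertex a)) i *: fg a).
Proof. by rewrite /= /restr_map linearZ /= diagE. Qed.

Lemma peak_free_y j i (e : i = j + 1) (p : {poly F}) a :
  qy peak_free e (p *: fg a) = p *: (rim_y F (Defs.arc k (peak_vertex a)) i *: fg a).
Proof. by rewrite /= /restr_map linearZ /= diagE. Qed.

Lemma peak_free_peak_x j i (e : i = j + 1) : pk i = pk j ->
  qx peak_free e (peak_gen j : peak_free j) = rim_x F I i *: peak_gen i.
Proof.
move=> ij; rewrite -[peak_gen j]scale1r peak_free_x scale1r -(peak_idx_eq ij).
by rewrite peak_vertexK /rim_x mem_arc_peak.
Qed.

Lemma peak_free_peak_y j i (e : i = j + 1) :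
  qy peak_free e (peak_gen i : peak_free i) = rim_y F I i *: peak_gen i.
Proof.
by rewrite -[in LHS](scale1r (peak_gen i)) peak_free_y scale1r peak_vertexK /rim_y mem_arc_peak.
Qed.

Lemma pres_dE c : pres_d (valley_vertex c) (fg c) =
  peak_gen (valley_vertex c) - peak_gen (valley_vertex c + 1).
Proof. exact: free_homE. Qed.

Lemma peak_step j i : i = j + 1 ->
  pk i = pk j \/ exists2 c, j = valley_vertex c & i \notin I.
Proof.
move=> e; have jE : i - 1 = j by rewrite e addrK.
have [iI|iI] := boolP (i \in I); first by left; rewrite (peak_in _ _ iI) jE.
have [jI|jI] := boolP (j \in I); last by left; rewrite (peak_notin _ _ iI) jE.
have jV : j \in V by rewrite inE jI -e.
by right; exists (enum_rank_in jV j); rewrite // /valley_vertex enum_rankK_in.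
Qed.

Definition pres_cong i (x y : {freeg 'I_#|U| / {poly F}}) : Prop :=
  exists u, pres_d i u = x - y.

Lemma pres_cong_refl i x : pres_cong i x x.
Proof. by exists 0; rewrite hom0 subrr. Qed.

Lemma pres_cong_trans i y x z : pres_cong i x y -> pres_cong i y z -> pres_cong i x z.
Proof. by move=> [u uE] [v vE]; exists (u + v); rewrite homD uE vE addrA subrK. Qed.

Lemma pres_congZ i p x y : pres_cong i x y -> pres_cong i (p *: x) (p *: y).
Proof.
move=> [u uE]; exists (p *: (u : center_mod valley_free i)).
by rewrite hom_act uE (free_act hn hkn peak_vertex) scalerBr.
Qed.

Lemma pres_congD i x y x' y' :
  pres_cong i x y -> pres_cong i x' y' -> pres_cong i (x + x') (y + y').
Proof. by move=> [u uE] [v vE]; exists (u + v); rewrite homD uE vE opprD addrACA. Qed.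

Lemma pres_cong_x j i (e : i = j + 1) x y :
  pres_cong j x y -> pres_cong i (qx peak_free e x) (qx peak_free e y).
Proof. by move=> [u uE]; exists (qx valley_free e u); rewrite hom_x uE linearB. Qed.

Lemma pres_cong_y j i (e : i = j + 1) x y :
  pres_cong i x y -> pres_cong j (qy peak_free e x) (qy peak_free e y).
Proof. by move=> [u uE]; exists (qy valley_free e u); rewrite hom_y uE linearB. Qed.

Lemma pres_cong_sym i x y : pres_cong i x y -> pres_cong i y x.
Proof. by move=> [u uE]; exists (- u); rewrite homN uE opprB. Qed.

(** Away from valleys the arrow acts on the chosen generators as it does on L_I; at
    a valley the two generators differ by the image of its summand. *)
Lemma peak_cong_y j i (e : i = j + 1) :
  pres_cong j (qy peak_free e (peak_gen i : peak_free i)) (rim_y F I i *: peak_gen j).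
Proof.
rewrite peak_free_peak_y; case: (peak_step e) => [/peak_idx_eq ij|[c jc iI]].
  by rewrite /peak_gen ij; exact: pres_cong_refl.
apply: pres_congZ; apply: pres_cong_sym; move: e; rewrite jc => ->.
by exists (fg c); rewrite pres_dE.
Qed.

(** At a valley, the statement is x applied to peak_cong_y, as x y = t. *)
Lemma peak_cong_x j i (e : i = j + 1) :
  pres_cong i (qx peak_free e (peak_gen j : peak_free j)) (rim_x F I i *: peak_gen i).
Proof.
case: (peak_step e) => [ij|[c jc iI]].
  by rewrite peak_free_peak_x //; exact: pres_cong_refl.
have := pres_cong_x e (peak_cong_y e).
rewrite /rim_x /rim_y (negPf iI) scale1r => /pres_cong_sym h.
apply: pres_cong_trans h _.
rewrite -rep_tE -act_X (free_act hn hkn peak_vertex).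
exact: pres_cong_refl.
Qed.

Lemma pres_epsZ i p (x : {freeg 'I_#|U| / {poly F}}) :
  pres_eps i (p *: x) = p * (pres_eps i x : {poly F}) :> {poly F}.
Proof. by rewrite hom_free_scale rank1_act. Qed.

(** As eps sends the chosen generator to 1 (pres_eps_peak), this property of all
    elements makes eps injective modulo boundaries. *)
Definition spanned i (x : {freeg 'I_#|U| / {poly F}}) : Prop :=
  pres_cong i x ((pres_eps i x : {poly F}) *: peak_gen i).

Lemma spanned_x j i (e : i = j + 1) x : spanned j x -> spanned i (qx peak_free e x).
Proof.
move=> sx; apply: pres_cong_trans (pres_cong_x e sx) _.
rewrite hom_x /= /poly_mul mulrC -scalerA /restr_map linearZ /=.
exact: pres_congZ (peak_cong_x e).
Qed.

Lemma spanned_y j i (e : i = j + 1) x : spanned i x -> spanned j (qy peak_free e x).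
Proof.
move=> sx; apply: pres_cong_trans (pres_cong_y e sx) _.
rewrite hom_y /= /poly_mul mulrC -scalerA /restr_map linearZ /=.
exact: pres_congZ (peak_cong_y e).
Qed.

Lemma spanned_xpath m i j (e : j = i + m%:R) (x : peak_free i) :
  spanned i x -> spanned j (xpath e x).
Proof.
move=> sx; elim: m j e => [|m IH] j e; first by rewrite /=; case: _ / (path_end0 e).
exact: (spanned_x (path_endS e) (IH _ _)).
Qed.

Lemma spanned_ypath m i j (e : j = i + m%:R) (x : peak_free j) :
  spanned j x -> spanned i (ypath e x).
Proof.
move=> sx; elim: m i e => [|m IH] i e; first by rewrite /=; case: _ / (esym (path_end0 e)).
exact: (spanned_y (erefl (i + 1)) (IH _ _)).
Qed.

Lemma pres_eps_own a : pres_eps (peak_vertex a) (fg a) = 1 :> {poly F}.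
Proof. exact: (free_homE hn hkn (vx := peak_vertex) (M := rank1 F hn hI) (fun=> 1 : {poly F}) a). Qed.

(** It holds for a peak generator at its own vertex and is preserved by arrows, so
    it holds for the generators at all vertices, which are their images under
    paths; it is also linear. *)
Lemma spanned_all i x : spanned i x.
Proof.
have sgen a : spanned i (fg a).
  rewrite -(gen_free F hn hkn peak_vertex i a) /gen.
  have s0 : spanned (peak_vertex a) (fg a).
    rewrite /spanned pres_eps_own scale1r /peak_gen peak_idxK; exact: pres_cong_refl.
  by case: ifP => _; [apply: spanned_xpath | apply: spanned_ypath].
rewrite -[x]freeg_sumE; apply: big_ind => [|u v su sv|a _].
- by rewrite /spanned hom0 scale0r; exact: pres_cong_refl.
- by rewrite /spanned homD scalerDl; exact: pres_congD su sv.
rewrite fgenZ /spanned pres_epsZ -scalerA; exact: pres_congZ (sgen a).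
Qed.

(** The path from a peak down its slope acts on L_I by 1 at every step. *)
Lemma pres_eps_peak i : pres_eps i (peak_gen i) = 1 :> {poly F}.
Proof.
have base u : u \in U -> pres_eps u (peak_gen u) = 1 :> {poly F}.
  by move=> uU; have := pres_eps_own (peak_idx u); rewrite peak_vertexK peak_id.
have := peakP x0I x1I i; have := peak_rim x0I x1I i; move: (pk i) => u uU.
rewrite /peak_spec; case: ifP => iI [d [e _ dm]].
  elim: d i {iI} e dm => [|d IH] i e dm; first by rewrite e addr0 base.
  have iI : i \in I by have := dm 0%N isT; rewrite subr0.
  have e1 : i = (i - 1) + 1 by rewrite subrK.
  have := peak_free_peak_x e1 (peak_in x0I x1I iI).
  rewrite /rim_x iI scale1r => <-; rewrite hom_x IH ?mulr1 /= /poly_mul /rim_x ?iI ?mulr1 //.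
    by rewrite e -natr1 addrA addrK.
  by move=> l ld; rewrite -addrA -opprD nat1r dm.
elim: d i {iI} e dm => [|d IH] i e dm; first by rewrite -[i]addr0 -e base.
have jI : i + 1 \notin I by have := dm 1%N isT.
have iI : i \notin I by have := dm 0%N isT; rewrite addr0.
have e1 : i + 1 = i + 1 by [].
have ij : peak_idx (i + 1) = peak_idx i.
  by apply: peak_idx_eq; rewrite (peak_notin x0I x1I jI) ?addrK.
have := peak_free_peak_y e1; rewrite /rim_y (negPf jI) scale1r.
rewrite {2}/peak_gen ij -/(peak_gen i) => <-.
rewrite hom_y IH /= /poly_mul /rim_y ?(negPf jI) ?mulr1 //.
  by rewrite e -nat1r addrA.
by move=> l ld; rewrite -addrA nat1r dm.
Qed.

Lemma pres_surj : hom_surj pres_eps.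
Proof. by move=> i v; exists ((v : {poly F}) *: peak_gen i); rewrite pres_epsZ pres_eps_peak mulr1. Qed.

Lemma pres_eps_d i u : pres_eps i (pres_d i u) = 0.
Proof.
apply: (@free_hom_ext F n k hn hkn _ valley_vertex _ (hom_comp pres_eps pres_d) 0) => c.
rewrite -[LHS]/(pres_eps _ (pres_d _ (fg c))) pres_dE homB pres_eps_peak.
have cV : valley_vertex c \in V by exact: enum_valP.
have /andP[_ c1] : (valley_vertex c \in I) && (valley_vertex c + 1 \notin I) by rewrite inE in cV.
have := peak_free_peak_y (erefl (valley_vertex c + 1)).
rewrite /rim_y (negPf c1) scale1r => <-.
by rewrite hom_y pres_eps_peak /= /poly_mul /rim_y (negPf c1) mulr1 subrr.
Qed.

Lemma pres_exact : exact_at pres_d pres_eps.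
Proof.
move=> i x; split=> [ex|[u <-]]; last exact: pres_eps_d.
have [u uE] := spanned_all i x; exists u; rewrite uE ex.
by rewrite -[X in X *: _]/(0 : {poly F}) scale0r subr0.
Qed.

(** A nonzero morphism from L_I to the projective at one peak, followed by eps, is an
    endomorphism of L_I, hence multiplication by one polynomial; it is seen to be a
    power of t at the peak, where eps is 1 on the generator. *)
Lemma pres_section : exists (s : rep_hom (rank1 F hn hI) peak_free) (m : nat),
  forall i u, pres_eps i (s i u) = ('X^m *: (u : center_mod (rank1 F hn hI) i) : center_mod _ i).
Proof.
pose a := peak_idx x0; pose A := Defs.arc k (peak_vertex a).
have [|c cE] := @rim_map_exists F n I A; first by rewrite hI card_arc.
pose s i (r : rank1 F hn hI i) : peak_free i := ((r : {poly F}) * 'X^(c i)) *: fg a.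
have sl i : linear (@s i).
  move=> l u v; rewrite /s -mul_polyC mulrDl scalerDl -mulrA -scalerA.
  by [].
have sx j i (e : i = j + 1) (r : rank1 F hn hI j) : s i (qx _ e r) = qx peak_free e (s j r).
  have jE : i - 1 = j by rewrite e addrK.
  rewrite /s peak_free_x scalerA; apply: (congr1 (fun z => z *: fg a)).
  rewrite /= /poly_mul mulrAC (mulrC (rim_x _ _ _)) cE jE mulrC.
  by rewrite (mulrC (rim_x _ _ _)) mulrA.
have sy j i (e : i = j + 1) (r : rank1 F hn hI i) : s j (qy _ e r) = qy peak_free e (s i r).
  have jE : i - 1 = j by rewrite e addrK.
  rewrite /s peak_free_y scalerA; apply: (congr1 (fun z => z *: fg a)).
  have := rim_map_y cE i; rewrite jE => cy.
  rewrite /= /poly_mul mulrAC (mulrC (rim_y _ _ _)) cy mulrC.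
  by rewrite (mulrC (rim_y _ _ _)) mulrA.
pose S := RepHom sl sx sy; exists S, (c (peak_vertex a)) => i u; rewrite rank1_act.
have S0 j (r : {poly F}) : S j r = (r * 'X^(c j)) *: fg a by [].
have SE j (r : {poly F}) : pres_eps j (S j r) = ((pres_eps j (S j (1 : {poly F})) : {poly F}) * r) :> {poly F}.
  by rewrite !S0 !pres_epsZ mul1r -mulrA mulrC.
(* an endomorphism of L_I is given by a scalar that no arrow can change *)
rewrite SE; congr (_ * _); move: i {u}.
have S1 j : pres_eps j (S j (1 : {poly F})) = 'X^(c j) * (pres_eps j (fg a) : {poly F}) :> {poly F}.
  by rewrite S0 pres_epsZ mul1r.
apply: (@circle_ind _ _ (peak_vertex a)) => [|j IH].
  by rewrite S1 pres_eps_own mulr1.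
rewrite -IH; apply: (mulfI (rim_x_neq0 F I (j + 1))).
have := hom_x pres_eps (erefl (j + 1)) (S j (1 : {poly F})).
rewrite -(hom_x S) -[RHS]/(rim_x F I (j + 1) * (pres_eps j (S j (1 : {poly F})) : {poly F})) => <-.
by rewrite [RHS]SE -[X in _ = _ * X]/(rim_x F I (j + 1) * 1) mulr1 mulrC.
Qed.

(** * Maps into a second rank one module *)

Section Dual.
Variables (J : {set 'Z_n}) (hJ : #|J| = k).
Local Notation N := (rank1 F hn hJ).
Local Notation DD := (Dstar F I J).

Definition cochain0 (f : 'cV[{poly F}]_#|U|) : rep_hom peak_free N :=
  free_hom hn hkn (vx := peak_vertex) (M := N) (fun a => f a 0).
Definition cochain1 (z : 'cV[{poly F}]_#|V|) : rep_hom valley_free N :=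
  free_hom hn hkn (vx := valley_vertex) (M := N) (fun c => z c 0).
Definition vec0 (g : rep_hom peak_free N) : 'cV[{poly F}]_#|U| :=
  \col_a (g (peak_vertex a) (fg a) : {poly F}).
Definition vec1 (g : rep_hom valley_free N) : 'cV[{poly F}]_#|V| :=
  \col_c (g (valley_vertex c) (fg c) : {poly F}).

Lemma vec0K g i u : cochain0 (vec0 g) i u = g i u.
Proof.
rewrite [RHS]free_hom_eta; congr (hom_fun (free_hom hn hkn _) u).
by apply/functional_extensionality_dep => a; rewrite mxE.
Qed.

Lemma vec1K g i u : cochain1 (vec1 g) i u = g i u.
Proof.
rewrite [RHS]free_hom_eta; congr (hom_fun (free_hom hn hkn _) u).
by apply/functional_extensionality_dep => a; rewrite mxE.
Qed.

Lemma cochain0K f a : cochain0 f (peak_vertex a) (fg a) = f a 0 :> {poly F}.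
Proof. exact: (free_homE hn hkn (vx := peak_vertex) (M := N) (fun a => f a 0) a). Qed.

Lemma cochain1K z c : cochain1 z (valley_vertex c) (fg c) = z c 0 :> {poly F}.
Proof. exact: (free_homE hn hkn (vx := valley_vertex) (M := N) (fun a => z a 0) c). Qed.

Lemma cochain0_gen f i a :
  cochain0 f i (fg a) = gen hn (M := N) (v := peak_vertex a) i (f a 0).
Proof. by rewrite -{1}[fg a](gen_free F hn hkn peak_vertex i) hom_gen cochain0K. Qed.

(** Down the x-slope, the arrow into a vertex outside J contributes a factor t. *)
Lemma gen_descent v (p : {poly F}) : v \in I ->
  gen hn (M := N) (v := peak_vertex (peak_idx v)) v p =
  'X^(#|cyc_interval (pk v) v :\: J|) * p :> {poly F}.
Proof.
move=> vI; have [d [/andP[_ dk] e]] := peak_run_in x0I x1I vI.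
have dN : (d < (Zp_trunc n).+2)%N by rewrite Zp_cast // (leq_ltn_trans dk) ?hI.
have e' : v = peak_vertex (peak_idx v) + d%:R by rewrite peak_vertexK.
rewrite (@gen_lo F n k hn hkn N _ _ d e') ?hI -?[X in (_ <= X)%N]hI //.
rewrite rank1_xpath prod_rim_x peak_vertexK; congr ('X^_ * _).
rewrite setDE setIC [X in cyc_interval _ X]e card_cyc_interval //.
by apply: eq_bigr => l _; rewrite inE.
Qed.

(** Down the y-slope, the arrow out of a vertex of J contributes a factor t. *)
Lemma gen_ascent v (p : {poly F}) : v + 1 \notin I ->
  gen hn (M := N) (v := peak_vertex (peak_idx (v + 1))) v p =
  'X^(#|J :&: cyc_interval v (pk (v + 1))|) * p :> {poly F}.
Proof.
move=> vI; have [d [dk e]] := peak_run_notin x0I x1I vI.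
have cC : (#|I| + #|~: I| = n)%N by rewrite cardsC card_ord Zp_cast.
have dk' : (d.+1 <= n - k)%N by rewrite -{1}cC hI addKn.
have dN : (d.+1 < n)%N.
  apply: leq_ltn_trans dk' _; rewrite ltn_subrL (leq_trans _ hkn) // andbT -hI.
  by apply/card_gt0P; exists x0.
have nd : (n - (n - d.+1) = d.+1)%N by rewrite subKn // ltnW.
have e1 : pk (v + 1) = v + d.+1%:R by rewrite e -nat1r addrA.
have e' : peak_vertex (peak_idx (v + 1)) = v + (n - (n - d.+1))%:R by rewrite nd peak_vertexK.
(* the path of y-arrows has length d + 1 at most n - k, so it is the shortest *)
rewrite (@gen_hi F n k hn hkn N _ _ (n - d.+1) e'); last first.
  by rewrite leq_subr andbT -[k](subKn (ltnW hkn)) leq_sub2l.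
rewrite rank1_ypath prod_rim_y nd; congr ('X^_ * _).
by rewrite e1 card_cyc_interval // Zp_cast.
Qed.

Lemma sum_if_eq (m : nat) (b : 'I_m) (G H : 'I_m -> {poly F}) :
  \sum_a (if a == b then G a else 0) * H a = G b * H b.
Proof. by rewrite (bigD1 b) //= eqxx big1 ?addr0 // => a /negPf->; rewrite mul0r. Qed.

(** D* is the matrix of restriction along the presentation: its two entries in the
    row of a valley are the actions on L_J of the two paths from the neighbouring
    peaks. *)
Lemma Dstar_mulE f c :
  (DD *m f) c 0 = cochain0 f (valley_vertex c) (pres_d (valley_vertex c) (fg c)) :> {poly F}.
Proof.
set v := valley_vertex c; have vV : v \in V by exact: enum_valP.
have /andP[vI v1] : (v \in I) && (v + 1 \notin I) by rewrite inE in vV.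
rewrite pres_dE homB !cochain0_gen gen_descent // gen_ascent //.
rewrite mxE; under eq_bigr => a _.
  rewrite mxE /dstar (precedes_peak x0I x1I) ?enum_valP // (follows_peak x0I x1I) ?enum_valP //.
  rewrite -/(peak_vertex a) -!peak_vertexK ![peak_vertex a == _](inj_eq enum_val_inj) mulrBl.
  over.
rewrite sumrB !sum_if_eq -!/(peak_vertex _) !peak_vertexK.
by [].
Qed.

Lemma Dstar_vec0 g c :
  (DD *m vec0 g) c 0 = g (valley_vertex c) (pres_d (valley_vertex c) (fg c)) :> {poly F}.
Proof. by rewrite Dstar_mulE vec0K. Qed.

Lemma cochain1_Dstar f i u : cochain1 (DD *m f) i u = cochain0 f i (pres_d i u).
Proof.
apply: (@free_hom_ext F n k hn hkn _ valley_vertex _ _ (hom_comp (cochain0 f) pres_d)) => c.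
by rewrite cochain1K Dstar_mulE.
Qed.

Lemma cochain0Z f i (p : {poly F}) x :
  cochain0 f i (p *: x) = p * (cochain0 f i x : {poly F}) :> {poly F}.
Proof. by rewrite hom_free_scale rank1_act. Qed.

(** The value at the generator of L_I over i of the map L_I -> L_J given by f.  It
    makes sense when f is killed by D*; when D* f is only divisible by m, it is
    a map modulo m, as peak_val_x and peak_val_y state. *)
Definition peak_val f i : {poly F} := cochain0 f i (peak_gen i).

Lemma peak_val_vertex f a : peak_val f (peak_vertex a) = f a 0.
Proof. by rewrite /peak_val /peak_gen peak_idxK cochain0K. Qed.

Lemma peak_val_dvd (m : {poly F}) (f : 'cV[{poly F}]_#|U|) i : m %| f (peak_idx i) 0 -> m %| peak_val f i.
Proof.
rewrite /peak_val cochain0_gen => dv.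
have [c cE] := rank1_gen F hn hJ (peak_vertex (peak_idx i)) i.
by rewrite cE dvdp_mull.
Qed.

Section Relations.
Variables (m : {poly F}) (f : 'cV[{poly F}]_#|U|).
Hypothesis mf : forall c : 'I_#|V|, m %| (DD *m f) c 0.

Lemma pres_cong_dvd i x y : pres_cong i x y ->
  m %| (cochain0 f i x : {poly F}) - (cochain0 f i y : {poly F}).
Proof.
move=> [u uE]; have -> : (cochain0 f i x : {poly F}) - (cochain0 f i y : {poly F}) =
    cochain1 (DD *m f) i u :> {poly F}.
  by rewrite cochain1_Dstar uE homB.
exact: free_hom_rank1_dvd.
Qed.

Lemma peak_val_x i : m %| rim_x F J i * peak_val f (i - 1) - rim_x F I i * peak_val f i.
Proof.
have e : i = (i - 1) + 1 by rewrite subrK.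
have := pres_cong_dvd (peak_cong_x e); rewrite cochain0Z hom_x; exact.
Qed.

Lemma peak_val_y i : m %| rim_y F J i * peak_val f i - rim_y F I i * peak_val f (i - 1).
Proof.
have e : i = (i - 1) + 1 by rewrite subrK.
have := pres_cong_dvd (peak_cong_y e); rewrite cochain0Z hom_y; exact.
Qed.

End Relations.

(** A morphism from L_I to L_J is determined by its value at one vertex, because the
    arrows act injectively. *)
Lemma Dstar_ker_trivial (f : 'cV[{poly F}]_#|U|) a : DD *m f = 0 -> f a 0 = 0 -> f = 0.
Proof.
move=> Df fa.
have step i : rim_x F J i * peak_val f (i - 1) = rim_x F I i * peak_val f i.
  apply/eqP; rewrite -subr_eq0 -dvd0p; apply: peak_val_x => c.
  by rewrite Df mxE dvdp0.
have p0 : forall i, peak_val f i = 0.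
  apply: (@circle_ind _ _ (peak_vertex a)) => [|j pj]; first by rewrite peak_val_vertex.
  have /eqP := step (j + 1); rewrite addrK pj mulr0 eq_sym mulf_eq0.
  by rewrite (negPf (rim_x_neq0 _ _ _)) => /eqP.
by apply/matrixP => b o; rewrite ord1 mxE -peak_val_vertex p0.
Qed.

(** The kernel contains the restriction to peaks of a nonzero morphism L_I -> L_J. *)
Lemma Dstar_singular : exists f : 'cV[{poly F}]_#|U|, f != 0 /\ DD *m f = 0.
Proof.
have [|c cE] := @rim_map_exists F n I J; first by rewrite hI hJ.
pose h i (r : rank1 F hn hI i) : rank1 F hn hJ i := 'X^(c i) * (r : {poly F}).
have hl i : linear (@h i).
  by move=> l u v; rewrite /h mulrDr scalerAr.
have hx j i (e : i = j + 1) (r : rank1 F hn hI j) : h i (qx _ e r) = qx (rank1 F hn hJ) e (h j r).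
  have jE : i - 1 = j by rewrite e addrK.
  by rewrite /h /= /poly_mul mulrA cE jE mulrA.
have hy j i (e : i = j + 1) (r : rank1 F hn hI i) : h j (qy _ e r) = qy (rank1 F hn hJ) e (h i r).
  have jE : i - 1 = j by rewrite e addrK.
  by have := rim_map_y cE i; rewrite /h /= /poly_mul jE !mulrA => ->.
pose g := hom_comp (RepHom hl hx hy) pres_eps.
exists (vec0 g); split; last first.
  apply/matrixP => b o; rewrite ord1 Dstar_vec0 mxE -[LHS]/(h _ (pres_eps _ (pres_d _ (fg b)))).
  by rewrite pres_eps_d /h mulr0.
apply/eqP => /matrixP/(_ (peak_idx x0) 0); rewrite !mxE.
rewrite -[LHS]/(h _ (pres_eps _ (fg (peak_idx x0)))) pres_eps_own /h mulr1.
by move/eqP; rewrite expf_eq0 polyX_eq0 andbF.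
Qed.

Section Boxes.
Hypothesis IJ : I <> J.
Variable lab : 'Z_n -> bool.
Hypothesis labE : forall i, lab i = carry (lab (i - 1)) (letter I J i).
Local Notation T := [set i | lab (i - 1) && ~~ lab i].

(** Modulo t, an element of I outside J forces the value at it to vanish, an element
    of J outside I the value just before it, and the value is unchanged across
    all other vertices; vanish_of_drops concludes. *)
Lemma Dstar_mod_ker (f : 'cV[{poly F}]_#|U|) :
  (forall c : 'I_#|V|, 'X %| (DD *m f) c 0) ->
  (forall i, i \in T -> 'X %| f (peak_idx (i - 1)) 0) ->
  forall a : 'I_#|U|, 'X %| f a 0.
Proof.
move=> mf sel a; rewrite -peak_val_vertex.
have px i := peak_val_x mf i; have py i := peak_val_y mf i.
have sub (u v : {poly F}) : 'X %| u - v -> ('X %| u) = ('X %| v).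
  by move=> uv; rewrite -[u](subrK v) dvdp_addr.
apply: (vanish_of_drops labE IJ (P := fun i => 'X %| peak_val f i)) => i.
- move=> iI iJ; have := sub _ _ (px i); rewrite /rim_x iI (negPf iJ) mul1r => <-.
  exact: dvdp_mulIl.
- move=> iI iJ; have := sub _ _ (py i); rewrite /rim_y iJ (negPf iI) mul1r => <-.
  exact: dvdp_mulIl.
- move=> e; case iI : (i \in I) e => /esym iJ.
    by have := sub _ _ (px i); rewrite /rim_x iI iJ !mul1r => ->.
  by have := sub _ _ (py i); rewrite /rim_y iI iJ !mul1r => ->.
by move=> iT; apply: peak_val_dvd; apply: sel.
Qed.

End Boxes.

(** In any resolution that extends the presentation, the next term covers the kernel
    of pres_d, so these are the cocycles. *)
Definition cocycle_vec (z : 'cV[{poly F}]_#|V|) : Prop :=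
  forall i u, pres_d i u = 0 -> cochain1 z i u = 0.

Lemma cocycle_vec_im f : cocycle_vec (DD *m f).
Proof. by move=> i u du; rewrite cochain1_Dstar du hom0. Qed.

Lemma cochain1Z (c : {poly F}) z i u : cochain1 (c *: z) i u = c * (cochain1 z i u : {poly F}) :> {poly F}.
Proof.
rewrite -free_hom_rank1Z; apply: (congr1 (fun m => free_hom hn hkn (vx := valley_vertex) (M := N) m i u)).
by apply/functional_extensionality_dep => a; rewrite mxE.
Qed.

Lemma cocycle_vec_sat (c : {poly F}) z : c != 0 -> cocycle_vec (c *: z) -> cocycle_vec z.
Proof.
move=> c0 cz i u du; have /eqP := cz i u du.
rewrite -[_ == 0]/((cochain1 (c *: z) i u : {poly F}) == 0) cochain1Z mulf_eq0.
by rewrite (negPf c0) => /eqP.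
Qed.

Lemma cocycle_vec_tors : exists m : nat,
  forall z, cocycle_vec z -> exists f, DD *m f = 'X^m *: z.
Proof.
have [s [m sE]] := pres_section; exists m => z zc.
have [g gE] := section_torsion hn hkn (@free_projective F n k hn hkn _ peak_vertex) pres_exact sE zc.
exists (vec0 g); apply/matrixP => c o; rewrite ord1 Dstar_vec0 -gE mxE.
rewrite -[LHS]/(('X^m *: (cochain1 z (valley_vertex c) (fg c) : center_mod N _)) : {poly F}).
by rewrite rank1_act cochain1K.
Qed.

End Dual.

End Presentation.

(** * The extension group *)

Section Final.
Variables (F : fieldType) (n k : nat) (hn : (1 < n)%N) (hkn : (k < n)%N).
Variables (I J : {set 'Z_n}) (hI : #|I| = k) (hJ : #|J| = k).
Variables (x0 x1 : 'Z_n) (x0I : x0 \in I) (x1I : x1 \notin I).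
Local Notation M := (rank1 F hn hI).
Local Notation N := (rank1 F hn hJ).
Local Notation DD := (Dstar F I J).
Local Notation p := #|rim_V I|.
Variables (r m : nat) (h : m.-tuple nat) (L : 'M[{poly F}]_p).
Local Notation cvec := (cocycle_vec hn hkn x0I x1I hJ).
Hypotheses (rmp : (r + m <= p)%N) (uL : L \in unitmx).
Hypothesis cvecE : forall z, cvec z <->
  forall i : 'I_p, (r + m <= i)%N -> (L *m z) i 0 = 0.
Hypothesis imE : forall z, cvec z -> (exists f, DD *m f = z) <->
  forall (j : 'I_m) (i : 'I_p), i = (r + j)%N :> nat -> 'X^(tnth h j) %| (L *m z) i 0.

(** Both Ext^1 and the product of cyclic modules are quotients of the module of
    cocycles of P: read the latter in the coordinates of L.  The two kernels agree
    since the image of D* is described by divisibility in these coordinates. *)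
Theorem Ext1_of_smith (P : proj_resolution M) :
  mod_iso (Ext1 P N) (prodmod (fun i : 'I_m => poly_quot ('X^(tnth h i) : {poly F}))).
Proof.
have [t [tker tcob tsurj]] := ext_comparison hn hkn N P
  (@free_projective F n k hn hkn _ (valley_vertex (I := I)))
  (@free_projective F n k hn hkn _ (peak_vertex (I := I)))
  (@pres_surj F n k hn hkn I hI x0 x1 x0I x1I) (@pres_exact F n k hn hkn I hI x0 x1 x0I x1I).
pose comp (z : Z1 P N) : rep_hom (valley_free F hn hkn I) N := hom_comp z t.
pose vec z : 'cV[{poly F}]_p := vec1 (comp z).
have bnd (j : 'I_m) : (r + j < p)%N by apply: leq_trans rmp; rewrite ltn_add2l.
pose row (j : 'I_m) : 'I_p := Ordinal (bnd j).
pose g z : prodmod (fun i : 'I_m => poly_quot ('X^(tnth h i) : {poly F})) :=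
  fun j => quot_proj (ideal ('X^(tnth h j) : {poly F})) ((L *m vec z) (row j) 0).
have vec_lin c z z' : vec (c *: z + z') = c *: vec z + vec z'.
  apply/matrixP => i o; rewrite !mxE.
  rewrite -[LHS]/(((c *: (z _ (t _ (fgen _ i)) : center_mod N _)) : {poly F}) + (z' _ (t _ (fgen _ i)) : {poly F})).
  by rewrite rank1_act.
have vec_coc z : cvec (vec z).
  by move=> i u du; rewrite vec1K; exact: (Z1_ker z (tker i u du)).
apply: (mod_iso_of_surj (f := quot_proj (@coboundary1 F n k M P N)) (g := g)).
- exact: quot_proj_linear.
- move=> c z z'; apply/functional_extensionality_dep => j.
  rewrite -[RHS]/(c *: g z j + g z' j) /g vec_lin mulmxDr -scalemxAr.
  rewrite -quot_proj_linear; congr quot_proj; by rewrite !mxE.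
- by move=> v; have [u uE] := quot_proj_surj v; exists u.
- move=> y; have /choice[q qE] : forall j, exists v : {poly F}, quot_proj (ideal ('X^(tnth h j))) v = y j.
    by move=> j; have [u uE] := quot_proj_surj (y j); exists u.
  pose a := \col_(i < p) (if insub (i - r)%N is Some j then if (r <= i)%N then q j else 0 else 0).
  pose z0 := invmx L *m a.
  have Lz0 : L *m z0 = a by rewrite mulKVmx.
  have z0c : cvec z0.
    apply/cvecE => i ri; rewrite Lz0 mxE insubF // ltn_subLR ?(leq_trans (leq_addr _ _) ri) //.
    by rewrite ltnNge ri.
  have [z [f zE]] := tsurj (cochain1 hn hkn hJ z0) z0c.
  exists z; apply/functional_extensionality_dep => j; rewrite -qE /g.
  have -> : vec z = z0 + DD *m vec0 f.
    apply/matrixP => i o; rewrite ord1 [RHS]mxE (Dstar_vec0 hI x0I x1I) mxE.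
    rewrite -[LHS]/(z _ (t _ (fgen _ i)) : {poly F}) zE.
    by congr (_ + _); rewrite cochain1K.
  have aE : a (row j) 0 = q j.
    rewrite mxE /= addKn leq_addr insubT //= => jm.
    by congr q; apply: val_inj.
  apply/quot_projP; rewrite mulmxDr Lz0 mxE aE.
  set b := (L *m (DD *m _)) _ _; have -> : q j + b - q j = b :> {poly F} by rewrite addrC addKr.
  have fc : cvec (DD *m vec0 f) by exact: cocycle_vec_im.
  by have /(imE fc)/(_ j (row j) erefl) : exists f', DD *m f' = DD *m vec0 f by exists (vec0 f).
move=> z; rewrite quot_proj_eq0; split=> [/tcob[f fE]|gz].
  apply/functional_extensionality_dep => j; apply/quot_proj_eq0.
  have : exists f, DD *m f = vec z.
    exists (vec0 f); apply/matrixP => i o; rewrite ord1 (Dstar_vec0 hI x0I x1I) -fE mxE.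
    by [].
  by move/(imE (vec_coc z))/(_ j (row j) erefl).
have /(imE (vec_coc z))[f fE] : forall (j : 'I_m) (i : 'I_p), i = (r + j)%N :> nat ->
    'X^(tnth h j) %| (L *m vec z) i 0.
  move=> j i ij; have -> : i = row j by apply: val_inj.
  have : g z j = 0 by rewrite gz.
  by move/quot_proj_eq0.
apply/tcob; exists (cochain0 hn hkn hJ f) => i u.
by rewrite -(cochain1_Dstar hI x0I x1I hJ f u) fE vec1K.
Qed.

End Final.

Theorem theorem3p1 (F : closedFieldType) (n k : nat)
    (hn : (1 < n)%N) (hk : (1 <= k <= n - 1)%N)
    (I J : {set 'Z_n}) (hI : #|I| = k) (hJ : #|J| = k) (hIJ : I <> J) :
  exists h : (num_boxes I J).-1.-tuple nat,
    [/\ sorted leq h,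
        exists m : nat, invariant_factors (Dstar F I J)
          (nseq m 1 ++ [seq 'X^e | e <- h])
      & forall P : proj_resolution (rank1 F hn hI),
          mod_iso (Ext1 P (rank1 F hn hJ))
            (prodmod (fun i : 'I_(num_boxes I J).-1 => poly_quot ('X^(tnth h i))))].
Proof.
have /andP[k0 kn1] := hk.
have hkn : (k < n)%N by rewrite -(subnKC (ltnW hn)) add1n ltnS.
have [x0 x0I] : exists x, x \in I by apply/card_gt0P; rewrite hI.
have [x1 x1I] : exists x, x \notin I.
  have : (0 < #|~: I|)%N.
    have cI : (#|I| + #|~: I| = n)%N by rewrite cardsC card_ord Zp_cast.
    by rewrite -(ltn_add2l k) addn0 -{2}hI cI.
  by move=> /card_gt0P[x]; rewrite inE; exists x.
have [lab [labE boxE]] := last_letter I J.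
pose sel (t : 'I_(num_boxes I J)) : 'I_#|rim_U I| :=
  peak_idx x0I x1I (enum_val (cast_ord boxE t) - 1).
have [m tors] := cocycle_vec_tors F hn hkn hI x0I x1I hJ.
have [|||||||h [hs inv rp [L uL [zE iE]]]] := @corank1_torsion_structure F #|rim_V I| #|rim_U I| (num_boxes I J) m
    (Dstar F I J) (cocycle_vec hn hkn x0I x1I hJ) (peak_idx x0I x1I x0) sel.
- exact: cocycle_vec_im.
- exact: cocycle_vec_sat.
- exact: tors.
- by move=> f; exact: (Dstar_ker_trivial hn hkn hI x0I x1I hJ).
- exact: (Dstar_singular F hn hkn hI x0I x1I hJ).
- move=> f mf fsel j.
  have := @Dstar_mod_ker F n k hn hkn I hI x0 x1 x0I x1I J hJ hIJ lab labE f mf; apply => i iT.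
  have := fsel (cast_ord (esym boxE) (enum_rank_in iT i)).
  by rewrite /sel cast_ordKV enum_rankK_in.
- by rewrite boxE; exact: card_drops_le.
exists h; split=> //; first by exists (#|rim_U I| - num_boxes I J)%N.
move=> P; exact: (Ext1_of_smith rp uL zE iE).
Qed.
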